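(* Let $n$ be an odd positive integer, $\zeta=e^{2\pi i/n}$, and let $x,y\in\mathbb{C}$ satisfy $x+\zeta^jy\notin\{0,-1,-2,\ldots\}$ for $j=0,1,\ldots,n-1$. Then, with infinite products over $m$ understood as zeta-regularized products, $$\prod_{m=0}^\infty\left((m+x)^n+y^n\right)^{(-1)^m}=\prod_{m=0}^{\infty}\left(\prod_{j=0}^{n-1}(m+x+\zeta^jy)^{(-1)^m}\right)=\frac{\left(\sqrt{\pi/2}\right)^n}{\prod_{j=0}^{n-1}\tilde\Gamma(x+\zeta^jy)}.$$
   Context: Complex powers use the principal branch. For a sequence $(a_m)_{m\ge0}$ of nonzero complex numbers, the zeta-regularized product $\prod_{m=0}^\infty a_m^{(-1)^m}$ is $\exp(-F'(0))$, where $F(s)=\sum_{m=0}^\infty(-1)^ma_m^{-s}$ for $\mathrm{Re}(s)>0$, analytically continued to a neighbourhood of $s=0$ (existence of the continuation being part of the assertion); when $a_m$ is written as a finite product $\prod_jb_{m,j}$, $a_m^{-s}$ is read as $\prod_jb_{m,j}^{-s}$. The modified gamma function is $$\tilde\Gamma(x)=\frac1x e^{x\log 2}\prod_{m=1}^\infty\left(e^{-x/m}\left(1+\frac xm\right)\right)^{(-1)^{m+1}},\qquad x\in\mathbb{C}\setminus\{0,-1,-2,\ldots\},$$ with this last infinite product an ordinary convergent product. *)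

(* Defs.v *)
From Stdlib Require Export Reals Lra Lia.
From Coquelicot Require Export Coquelicot.

Open Scope C_scope.

Definition Cexp (z : C) : C :=
  (exp (Re z) * cos (Im z), exp (Re z) * sin (Im z))%R.

(* Principal argument, with values in (-PI, PI]; the value at 0 is irrelevant. *)
Definition Carg (z : C) : R :=
  if Rle_dec 0 (Im z) then acos (Re z / Cmod z) else (- acos (Re z / Cmod z))%R.

Definition Clog (z : C) : C := (ln (Cmod z), Carg z).

Definition Cpower (z s : C) : C := Cexp (s * Clog z).

Lemma Carg_bounds (z : C) : (- PI < Carg z <= PI)%R.
Proof.
unfold Carg; destruct (Rle_dec 0 (Im z)) as [h|h].
- destruct (acos_bound (Re z / Cmod z)); pose proof PI_RGT_0; lra.
- assert (hz : z <> 0) by (intros ->; apply h; simpl; lra).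
  apply Cmod_gt_0 in hz.
  cut (-1 < Re z / Cmod z < 1)%R; [intros hc; destruct (acos_bound_lt _ hc); lra|].
  assert (e : (Cmod z ^ 2 = Re z ^ 2 + Im z ^ 2)%R) by exact (Cmod2_alt z).
  assert (hi : (0 < Im z ^ 2)%R) by nra.
  set (c := (Re z / Cmod z)%R).
  assert (ec : Re z = (c * Cmod z)%R) by (unfold c; field; lra).
  rewrite ec in e.
  assert (0 < Cmod z ^ 2 * (1 - c ^ 2))%R by nra.
  assert (0 < Cmod z ^ 2)%R by nra.
  assert (c ^ 2 < 1)%R by nra.
  split; nra.
Qed.

Lemma Cexp_Clog (z : C) : z <> 0 -> Cexp (Clog z) = z.
Proof.
intros hz; apply Cmod_gt_0 in hz.
assert (e : (Cmod z ^ 2 = Re z ^ 2 + Im z ^ 2)%R) by exact (Cmod2_alt z).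
set (c := (Re z / Cmod z)%R).
assert (ec : Re z = (c * Cmod z)%R) by (unfold c; field; lra).
assert (h2 : (0 < Cmod z ^ 2)%R) by nra.
assert (hc2 : (0 <= 1 - c ^ 2)%R).
{ assert (0 <= Cmod z ^ 2 * (1 - c ^ 2))%R
    by (rewrite ec in e; pose proof (pow2_ge_0 (Im z)); nra).
  apply Rnot_lt_le; intro; nra. }
assert (hc : (-1 <= c <= 1)%R) by (split; nra).
assert (hs : (Cmod z * sqrt (1 - c ^ 2) = Rabs (Im z))%R).
{ apply Rsqr_inj.
  - apply Rmult_le_pos; [lra | apply sqrt_pos].
  - apply Rabs_pos.
  - rewrite <- Rsqr_abs, Rsqr_mult, Rsqr_sqrt by exact hc2.
    unfold Rsqr; rewrite ec in e; nra. }
unfold Cexp, Clog; simpl Re; simpl Im.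
rewrite exp_ln by exact hz.
rewrite (surjective_pairing z) at 5; change (fst z) with (Re z); change (snd z) with (Im z).
unfold Carg; fold c; destruct (Rle_dec 0 (Im z)) as [h|h].
- rewrite cos_acos, sin_acos by exact hc.
  rewrite Rsqr_pow2, hs, Rabs_pos_eq by exact h.
  f_equal; rewrite ec at 1; ring.
- rewrite cos_neg, sin_neg, cos_acos, sin_acos by exact hc.
  rewrite Rsqr_pow2, Ropp_mult_distr_r_reverse, hs, Rabs_left by lra.
  f_equal; [rewrite ec at 1|]; ring.
Qed.

Fixpoint Cprod (b : nat -> C) (n : nat) : C :=
  match n with
  | O => 1
  | S k => Cprod b k * b k
  end.

(* The limit of a convergent sequence, taken coordinatewise. *)
Definition Clim_seq (u : nat -> C) : C :=
  (real (Lim_seq (fun N => Re (u N))), real (Lim_seq (fun N => Im (u N)))).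

(* [z ^ ((-1) ^ m)] *)
Definition Calt (z : C) (m : nat) : C := if Nat.even m then z else / z.

(* The factor of index [k] in the partial products is the one for [m = k + 1]. *)
Definition tGamma_factor (x : C) (m : nat) : C :=
  Calt (Cexp (- (x / INR m)) * (1 + x / INR m)) (m + 1).

Definition tGamma (x : C) : C :=
  / x * Cexp (x * ln 2) * Clim_seq (Cprod (fun k => tGamma_factor x (S k))).

(* [p m s] stands for the reading of [a_m ^ (-s)].  [F] is the alternating
   series on the right half-plane together with its continuation to a disk
   around 0.  The union of these two sets is open and connected, so [F] is
   determined on it, and [P] is unique. *)
Definition zeta_reg_value (p : nat -> C -> C) (P : C) : Prop :=
  exists (F : C -> C) (r : R),
    (0 < r)%R /\
    (forall s : C, (0 < Re s)%R -> is_series (fun m => RtoC (-1) ^ m * p m s) (F s)) /\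
    (forall s : C, (0 < Re s)%R \/ (Cmod s < r)%R -> ex_derive F s) /\
    P = Cexp (- C_derive F 0).

(* [P] is the zeta-regularized product of the [a m ^ ((-1) ^ m)]. *)
Definition is_zeta_prod (a : nat -> C) (P : C) : Prop :=
  (forall m, a m <> 0) /\
  zeta_reg_value (fun m s => Cpower (a m) (- s)) P.

(* The same for [a m] written as the product of the [b m j], [j < n]. *)
Definition is_zeta_prod_factored (n : nat) (b : nat -> nat -> C) (P : C) : Prop :=
  (forall m, Cprod (b m) n <> 0) /\
  zeta_reg_value (fun m s => Cprod (fun j => Cpower (b m j) (- s)) n) P.

(* Main.v *)
Require Import Defs.
Open Scope C_scope.

(** Choose a logarithm [L m] of each base, so that the series is the sum of
    [(-1) ^ m * exp (- s * L m)].  The analysis uses only the shape of [L], recorded in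
    [LogLike]: [L m = d * ln (m + 1) + O(1)] with [d > 0], while the first and second
    differences of [L] are [O(1 / m)] and [O(1 / m ^ 2)].

    Euler's transformation, applied twice, rewrites an alternating sum as
    [f 0 / 2 + (f 0 - f 1) / 4 + (1 / 4) * sum (-1) ^ m (f m - 2 f (m + 1) + f (m + 2))].
    The second difference of [exp (- s * L m)] gains two powers of [m], so the transformed
    sum, [euler_sum], converges absolutely on a half-plane containing 0 and is the
    continuation of the series.  Its terms have second-order Taylor remainders with summable
    constants ([jet_bound]), so it may be differentiated term by term; at 0 this gives
    [- F' 0 = euler_sum L].  Undoing the transformation for [L] itself, the regularized
    product is the limit of [prod_(m < N) a_m ^ ((-1) ^ m)] times the square root
    [exp (L N / 2)] or its inverse, according to the parity of [N]
    ([zeta_reg_value_LogLike]).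

    For [a_m = m + z] these corrected partial products differ from the partial products
    that define [1 / tGamma z] by three factors: the alternating harmonic series, whose sum
    [ln 2] cancels the factor [exp (z ln 2)]; the corrected partial products for
    [a_m = m + 1], which tend to [sqrt (2 / PI)] by Wallis' formula
    ([regularized_ln_sum]); and a factor tending to 1.  Hence [tGamma_regularized].
    The limits are exponentials of expressions linear in [L], so the sum of the logarithms of
    [m + x + zeta ^ j * y] over [j] gives the product of the values.

    Since [n] is odd, [(m + x) ^ n + y ^ n] factors as the product of the
    [m + x + zeta ^ j * y] ([prod_roots_of_unity]).  The arguments of the factors tend to 0,
    so for large [m] the principal logarithm of the product is the sum of the principal
    logarithms.  The finitely many other [m] change [L m] by multiples of [2 * PI * i], which
    affects neither [LogLike] nor the exponentials of partial sums; both readings of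
    the product therefore have the same value. *)

(** * Convergence of complex sequences *)

Definition Ccv (u : nat -> C) (l : C) : Prop :=
  is_lim_seq (fun n => Cmod (u n - l)) 0%R.

Lemma Re_minus (a b : C) : Re (a - b) = (Re a - Re b)%R.
Proof. destruct a, b; reflexivity. Qed.

Lemma Im_minus (a b : C) : Im (a - b) = (Im a - Im b)%R.
Proof. destruct a, b; reflexivity. Qed.

Lemma Cmod_le_abs (z : C) : Cmod z <= Rabs (Re z) + Rabs (Im z).
Proof.
replace z with (RtoC (Re z) + Ci * RtoC (Im z)) at 1.
- eapply Rle_trans; [apply Cmod_triangle|].
  rewrite Cmod_mult, Cmod_Ci, !Cmod_R; lra.
- destruct z as [a b]; unfold Cplus, Cmult, Ci, RtoC; simpl; f_equal; ring.
Qed.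

Lemma Cmod_sub_le (a b : C) : Cmod (a - b) <= Cmod a + Cmod b.
Proof.
unfold Cminus; eapply Rle_trans; [apply Cmod_triangle|]; rewrite Cmod_opp; lra.
Qed.

Lemma im_le_Cmod (z : C) : Rabs (Im z) <= Cmod z.
Proof. eapply Rle_trans; [|apply Rmax_Cmod]; apply Rmax_r. Qed.

Lemma Ccv_squeeze (u : nat -> C) (l : C) (v : nat -> R) :
  is_lim_seq v 0%R -> (exists N, forall n, (N <= n)%nat -> Cmod (u n - l) <= v n) ->
  Ccv u l.
Proof.
intros hv [N hN].
apply (is_lim_seq_le_le_loc (fun _ => 0%R) _ v).
- exists N; intros n hn; split; [apply Cmod_ge_0 | now apply hN].
- apply is_lim_seq_const.
- exact hv.
Qed.

Lemma Ccv_ext_loc (u v : nat -> C) (l : C) :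
  (exists N, forall n, (N <= n)%nat -> u n = v n) -> Ccv u l -> Ccv v l.
Proof.
intros [N h] hu; apply (Ccv_squeeze v l (fun n => Cmod (u n - l)%C) hu).
exists N; intros n hn; rewrite (h n hn); lra.
Qed.

Lemma Ccv_ext (u v : nat -> C) (l : C) :
  (forall n, u n = v n) -> Ccv u l -> Ccv v l.
Proof. intros h; apply Ccv_ext_loc; exists 0%nat; auto. Qed.

Lemma Ccv_const (l : C) : Ccv (fun _ => l) l.
Proof.
unfold Ccv; apply (is_lim_seq_ext (fun _ => 0%R)).
- intros _; replace (l - l) with (RtoC 0) by ring; now rewrite Cmod_0.
- apply is_lim_seq_const.
Qed.

Lemma Ccv_plus (u v : nat -> C) (a b : C) :
  Ccv u a -> Ccv v b -> Ccv (fun n => u n + v n) (a + b).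
Proof.
intros hu hv.
apply (Ccv_squeeze _ _ (fun n => Cmod (u n - a) + Cmod (v n - b))%R).
- replace (0%R) with (0 + 0)%R by ring; now apply is_lim_seq_plus'.
- exists 0%nat; intros n _.
  replace (u n + v n - (a + b)) with ((u n - a) + (v n - b)) by ring.
  apply Cmod_triangle.
Qed.

Lemma Ccv_scal (u : nat -> C) (c a : C) :
  Ccv u a -> Ccv (fun n => c * u n) (c * a).
Proof.
intros hu.
apply (Ccv_squeeze _ _ (fun n => Cmod c * Cmod (u n - a))%R).
- replace (Finite 0) with (Finite (Cmod c * 0)%R) by (f_equal; ring).
  now apply is_lim_seq_mult'; [apply is_lim_seq_const|].
- exists 0%nat; intros n _; rewrite <- Cmod_mult.
  right; f_equal; ring.
Qed.

Lemma Ccv_RtoC (u : nat -> R) (l : R) :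
  is_lim_seq u l -> Ccv (fun n => RtoC (u n)) l.
Proof.
intros hu; unfold Ccv.
apply (is_lim_seq_ext (fun n => Rabs (u n - l))).
- intros n; rewrite <- RtoC_minus, Cmod_R; reflexivity.
- rewrite <- Rabs_R0; apply (is_lim_seq_abs _ (0%R : Rbar)).
  replace (Finite 0) with (Finite (l - l)%R) by (f_equal; ring).
  apply is_lim_seq_minus'; [exact hu | apply is_lim_seq_const].
Qed.

Lemma Ccv_incr (u : nat -> C) (l : C) : Ccv u l <-> Ccv (fun n => u (S n)) l.
Proof.
unfold Ccv; exact (is_lim_seq_incr_1 (fun n => Cmod (u n - l)%C) 0%R).
Qed.

Lemma Ccv_re (u : nat -> C) (l : C) : Ccv u l -> is_lim_seq (fun n => Re (u n)) (Re l).
Proof.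
intros hu.
apply (is_lim_seq_le_le (fun n => Re l - Cmod (u n - l)%C)%R _
        (fun n => Re l + Cmod (u n - l)%C)%R).
- intros n; pose proof (re_le_Cmod (u n - l)) as h.
  rewrite Re_minus in h.
  apply Rabs_le_between in h; lra.
- replace (Finite (Re l)) with (Finite (Re l - 0)%R) by (f_equal; ring).
  apply is_lim_seq_minus'; [apply is_lim_seq_const | exact hu].
- replace (Finite (Re l)) with (Finite (Re l + 0)%R) by (f_equal; ring).
  apply is_lim_seq_plus'; [apply is_lim_seq_const | exact hu].
Qed.

Lemma Ccv_im (u : nat -> C) (l : C) : Ccv u l -> is_lim_seq (fun n => Im (u n)) (Im l).
Proof.
intros hu; apply (Ccv_scal u (- Ci)) in hu; apply Ccv_re in hu.
assert (e : forall z : C, Re (- Ci * z) = Im z)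
  by (intros [a b]; unfold Re, Im, Ci; simpl; ring).
rewrite e in hu; revert hu; apply is_lim_seq_ext; intros n; apply e.
Qed.

Lemma Ccv_of_re_im (u : nat -> C) (l : C) :
  is_lim_seq (fun n => Re (u n)) (Re l) -> is_lim_seq (fun n => Im (u n)) (Im l) ->
  Ccv u l.
Proof.
intros hr hi; apply Ccv_RtoC in hr; apply Ccv_RtoC in hi.
assert (e : forall z : C, RtoC (Re z) + Ci * RtoC (Im z) = z).
{ intros [a b]; unfold Cplus, Cmult, Ci, RtoC; simpl; f_equal; ring. }
rewrite <- (e l).
apply (Ccv_ext (fun n => RtoC (Re (u n)) + Ci * RtoC (Im (u n)))); [intros n; apply e|].
apply Ccv_plus; [exact hr | now apply Ccv_scal].
Qed.

Lemma Ccv_unique (u : nat -> C) (a b : C) : Ccv u a -> Ccv u b -> a = b.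
Proof.
intros ha hb.
assert (hr : Finite (Re a) = Finite (Re b)).
{ rewrite <- (is_lim_seq_unique _ _ (Ccv_re _ _ ha)); apply is_lim_seq_unique, Ccv_re, hb. }
assert (hi : Finite (Im a) = Finite (Im b)).
{ rewrite <- (is_lim_seq_unique _ _ (Ccv_im _ _ ha)); apply is_lim_seq_unique, Ccv_im, hb. }
injection hr; injection hi; destruct a, b; simpl; intros; subst; reflexivity.
Qed.

Lemma Clim_seq_Ccv (u : nat -> C) (l : C) : Ccv u l -> Clim_seq u = l.
Proof.
intros h; unfold Clim_seq.
rewrite (is_lim_seq_unique _ _ (Ccv_re _ _ h)), (is_lim_seq_unique _ _ (Ccv_im _ _ h)).
now destruct l.
Qed.

Lemma Ccv_bound (u : nat -> C) (l : C) (B : R) :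
  Ccv u l -> (forall n, Cmod (u n) <= B) -> Cmod l <= B.
Proof.
intros hu hB.
assert (h : is_lim_seq (fun n => B + Cmod (u n - l)%C)%R (B + 0)%R)
  by (apply is_lim_seq_plus'; [apply is_lim_seq_const | exact hu]).
rewrite Rplus_0_r in h.
apply (is_lim_seq_le (fun _ => Cmod l) _ (Cmod l) B) in h; [exact h | | apply is_lim_seq_const].
intros n; replace l with (u n - (u n - l)) at 1 by ring.
eapply Rle_trans; [apply Cmod_sub_le|]; specialize (hB n); lra.
Qed.

Lemma Ccv_of_bounded_decay (u : nat -> C) (v : nat -> C) (c : R) :
  (forall n, Cmod (v n) <= c) -> Ccv u 0 -> Ccv (fun n => v n * u n) 0.
Proof.
intros hv hu; apply (Ccv_squeeze _ _ (fun n => c * Cmod (u n - 0)%C)%R).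
- replace (Finite 0) with (Finite (c * 0)%R) by (f_equal; ring).
  apply is_lim_seq_mult'; [apply is_lim_seq_const | exact hu].
- exists 0%nat; intros n _.
  replace (v n * u n - 0) with (v n * (u n - 0)) by ring.
  rewrite Cmod_mult; apply Rmult_le_compat_r; [apply Cmod_ge_0 | apply hv].
Qed.

(** * The complex exponential *)

Lemma Cexp_plus (a b : C) : Cexp (a + b) = Cexp a * Cexp b.
Proof.
unfold Cexp, Cmult; destruct a as [a1 a2], b as [b1 b2]; simpl.
rewrite exp_plus, cos_plus, sin_plus; f_equal; ring.
Qed.

Lemma Cexp_0 : Cexp 0 = 1.
Proof. unfold Cexp; simpl; rewrite exp_0, cos_0, sin_0; unfold RtoC; f_equal; ring. Qed.

Lemma Cexp_opp_mult (a : C) : Cexp (- a) * Cexp a = 1.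
Proof. rewrite <- Cexp_plus; replace (- a + a) with (RtoC 0) by ring; apply Cexp_0. Qed.

Lemma Cmod_Cexp (z : C) : Cmod (Cexp z) = exp (Re z).
Proof.
unfold Cmod, Cexp; simpl fst; simpl snd.
replace ((exp (Re z) * cos (Im z)) ^ 2 + (exp (Re z) * sin (Im z)) ^ 2)%R
  with ((exp (Re z)) ^ 2 * ((sin (Im z))² + (cos (Im z))²))%R by (unfold Rsqr; ring).
rewrite sin2_cos2, Rmult_1_r, <- Rsqr_pow2, sqrt_Rsqr; [reflexivity|].
left; apply exp_pos.
Qed.

Lemma Cexp_neq_0 (z : C) : Cexp z <> 0.
Proof. apply Cmod_gt_0; rewrite Cmod_Cexp; apply exp_pos. Qed.

Lemma Cexp_opp (a : C) : Cexp (- a) = / Cexp a.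
Proof.
pose proof (Cexp_neq_0 a) as h; pose proof (Cexp_opp_mult a) as e.
replace (/ Cexp a) with (Cexp (- a) * Cexp a * / Cexp a) by (rewrite e; field; exact h).
field; exact h.
Qed.

Lemma Cexp_minus (a b : C) : Cexp (a - b) = Cexp a / Cexp b.
Proof. unfold Cminus; now rewrite Cexp_plus, Cexp_opp. Qed.

Lemma Cexp_RtoC (t : R) : Cexp (RtoC t) = RtoC (exp t).
Proof. unfold Cexp; simpl; rewrite cos_0, sin_0; unfold RtoC; f_equal; ring. Qed.

Lemma exp_le (a b : R) : a <= b -> exp a <= exp b.
Proof. intros [h| ->]; [left; now apply exp_increasing | apply Rle_refl]. Qed.

Lemma Cmod_Cexp_le (z : C) : Cmod (Cexp z) <= exp (Cmod z).
Proof.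
rewrite Cmod_Cexp; apply exp_le.
eapply Rle_trans; [apply Rle_abs | apply re_le_Cmod].
Qed.

Lemma mean_value_01 (f f' : R -> R) (M : R) :
  (forall t, is_derive f t (f' t)) -> (forall t, 0 <= t <= 1 -> Rabs (f' t) <= M) ->
  Rabs (f 1%R - f 0%R) <= M.
Proof.
intros hf hM.
destruct (MVT_gen f 0 1 f') as [c [hc e]].
- intros t _; apply hf.
- intros t _; apply continuity_pt_filterlim, (ex_derive_continuous f t); now exists (f' t).
- rewrite Rmin_left, Rmax_right in hc by lra.
  rewrite e, Rminus_0_r, Rmult_1_r; now apply hM.
Qed.

Lemma Cexp_ray (a b t : R) :
  Cexp (RtoC t * (a, b)) = (exp (t * a) * cos (t * b), exp (t * a) * sin (t * b))%R.
Proof.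
unfold Cexp, Re, Im, RtoC; simpl.
replace (t * a - 0 * b)%R with (t * a)%R by ring.
replace (t * b + 0 * a)%R with (t * b)%R by ring; reflexivity.
Qed.

Lemma is_derive_Re_Cexp_ray (z : C) (t : R) :
  is_derive (fun t => Re (Cexp (RtoC t * z))) t (Re (z * Cexp (RtoC t * z))).
Proof.
destruct z as [a b]; rewrite Cexp_ray.
apply (is_derive_ext (fun t => exp (t * a) * cos (t * b))%R).
- intros u; now rewrite Cexp_ray.
- unfold Re; simpl; auto_derive; [trivial | ring].
Qed.

Lemma is_derive_Im_Cexp_ray (z : C) (t : R) :
  is_derive (fun t => Im (Cexp (RtoC t * z))) t (Im (z * Cexp (RtoC t * z))).
Proof.
destruct z as [a b]; rewrite Cexp_ray.
apply (is_derive_ext (fun t => exp (t * a) * sin (t * b))%R).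
- intros u; now rewrite Cexp_ray.
- unfold Im; simpl; auto_derive; [trivial | ring].
Qed.

Lemma Cexp_ray_le (z : C) (t : R) : 0 <= t <= 1 -> Cmod (Cexp (t * z)) <= exp (Cmod z).
Proof.
intros ht; eapply Rle_trans; [apply Cmod_Cexp_le|]; apply exp_le.
rewrite Cmod_mult, Cmod_R, Rabs_pos_eq by lra.
pose proof (Cmod_ge_0 z); nra.
Qed.

(** The mean value theorem along the ray [t * z] bounds the real and the imaginary part
    separately; this is where the factor 2 comes from. *)
Lemma Cexp_sub_1_bound (z : C) : Cmod (Cexp z - 1) <= 2 * Cmod z * exp (Cmod z).
Proof.
assert (hb : forall t, 0 <= t <= 1 -> Cmod (z * Cexp (t * z)) <= Cmod z * exp (Cmod z)).
{ intros t ht; rewrite Cmod_mult; apply Rmult_le_compat_l; [apply Cmod_ge_0|].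
  now apply Cexp_ray_le. }
pose proof (mean_value_01 (fun t => Re (Cexp (t * z))) (fun t => Re (z * Cexp (t * z)))
  (Cmod z * exp (Cmod z))%R) as h1.
pose proof (mean_value_01 (fun t => Im (Cexp (t * z))) (fun t => Im (z * Cexp (t * z)))
  (Cmod z * exp (Cmod z))%R) as h2.
eapply Rle_trans; [apply Cmod_le_abs|].
replace (Re (Cexp z - 1)) with (Re (Cexp (1%R * z)) - Re (Cexp (0%R * z)))%R.
2:{ rewrite <- Re_minus; f_equal; replace (0%R * z) with (RtoC 0) by ring;
    rewrite Cexp_0, Cmult_1_l; ring. }
replace (Im (Cexp z - 1)) with (Im (Cexp (1%R * z)) - Im (Cexp (0%R * z)))%R.
2:{ rewrite <- Im_minus; f_equal; replace (0%R * z) with (RtoC 0) by ring;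
    rewrite Cexp_0, Cmult_1_l; ring. }
apply Rle_trans with (Cmod z * exp (Cmod z) + Cmod z * exp (Cmod z))%R; [|lra].
apply Rplus_le_compat.
- apply h1.
  + intros t; apply is_derive_Re_Cexp_ray.
  + intros t ht; eapply Rle_trans; [apply re_le_Cmod | now apply hb].
- apply h2.
  + intros t; apply is_derive_Im_Cexp_ray.
  + intros t ht; eapply Rle_trans; [apply im_le_Cmod | now apply hb].
Qed.

(** Again the mean value theorem along [t * z]: the derivative of [exp (t z) - t z] is
    [z * (exp (t z) - 1)], to which the previous bound applies. *)
Lemma Cexp_sub_linear_bound (z : C) :
  Cmod (Cexp z - 1 - z) <= 4 * Cmod z ^ 2 * exp (Cmod z).
Proof.
assert (hb : forall t, 0 <= t <= 1 ->
  Cmod (z * (Cexp (t * z) - 1)) <= 2 * Cmod z ^ 2 * exp (Cmod z)).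
{ intros t ht; rewrite Cmod_mult.
  replace (2 * Cmod z ^ 2 * exp (Cmod z))%R
    with (Cmod z * (2 * Cmod z * exp (Cmod z)))%R by ring.
  apply Rmult_le_compat_l; [apply Cmod_ge_0|].
  eapply Rle_trans; [apply Cexp_sub_1_bound|].
  pose proof (Cmod_ge_0 z).
  assert (e : Cmod (t * z) <= Cmod z)
    by (rewrite Cmod_mult, Cmod_R, Rabs_pos_eq by lra; nra).
  apply Rmult_le_compat; [|left; apply exp_pos| |now apply exp_le].
  - pose proof (Cmod_ge_0 (t * z)); lra.
  - lra. }
pose proof (mean_value_01 (fun t => Re (Cexp (t * z) - t * z))
  (fun t => Re (z * (Cexp (t * z) - 1))) (2 * Cmod z ^ 2 * exp (Cmod z))%R) as h1.
pose proof (mean_value_01 (fun t => Im (Cexp (t * z) - t * z))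
  (fun t => Im (z * (Cexp (t * z) - 1))) (2 * Cmod z ^ 2 * exp (Cmod z))%R) as h2.
eapply Rle_trans; [apply Cmod_le_abs|].
replace (Re (Cexp z - 1 - z))
  with (Re (Cexp (1%R * z) - 1%R * z) - Re (Cexp (0%R * z) - 0%R * z))%R.
2:{ rewrite <- Re_minus; f_equal; replace (0%R * z) with (RtoC 0) by ring;
    rewrite Cexp_0, Cmult_1_l; ring. }
replace (Im (Cexp z - 1 - z))
  with (Im (Cexp (1%R * z) - 1%R * z) - Im (Cexp (0%R * z) - 0%R * z))%R.
2:{ rewrite <- Im_minus; f_equal; replace (0%R * z) with (RtoC 0) by ring;
    rewrite Cexp_0, Cmult_1_l; ring. }
apply Rle_trans with
  (2 * Cmod z ^ 2 * exp (Cmod z) + 2 * Cmod z ^ 2 * exp (Cmod z))%R; [|lra].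
apply Rplus_le_compat.
- apply h1.
  + intros t.
    apply (is_derive_ext (fun t => Re (Cexp (RtoC t * z)) - t * Re z)%R).
    * intros u; rewrite Re_minus; f_equal; destruct z; unfold Re, Im; simpl; ring.
    * replace (Re (z * (Cexp (RtoC t * z) - 1)))
        with (Re (z * Cexp (RtoC t * z)) - 1 * Re z)%R.
      2:{ replace (z * (Cexp (RtoC t * z) - 1)) with (z * Cexp (RtoC t * z) - z) by ring.
          rewrite Re_minus; ring. }
      apply (is_derive_minus (V := R_NormedModule)); [apply is_derive_Re_Cexp_ray | auto_derive; [trivial|ring]].
  + intros t ht; eapply Rle_trans; [apply re_le_Cmod | now apply hb].
- apply h2.
  + intros t.
    apply (is_derive_ext (fun t => Im (Cexp (RtoC t * z)) - t * Im z)%R).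
    * intros u; rewrite Im_minus; f_equal; destruct z; unfold Re, Im; simpl; ring.
    * replace (Im (z * (Cexp (RtoC t * z) - 1)))
        with (Im (z * Cexp (RtoC t * z)) - 1 * Im z)%R.
      2:{ replace (z * (Cexp (RtoC t * z) - 1)) with (z * Cexp (RtoC t * z) - z) by ring.
          rewrite Im_minus; ring. }
      apply (is_derive_minus (V := R_NormedModule)); [apply is_derive_Im_Cexp_ray | auto_derive; [trivial|ring]].
  + intros t ht; eapply Rle_trans; [apply im_le_Cmod | now apply hb].
Qed.

Lemma Ccv_Cexp (u : nat -> C) (l : C) : Ccv u l -> Ccv (fun n => Cexp (u n)) (Cexp l).
Proof.
intros hu; unfold Ccv in *.
apply (Ccv_squeeze _ _
  (fun n => exp (Re l) * (2 * Cmod (u n - l)%C * exp (Cmod (u n - l)%C)))%R).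
- replace (Finite 0) with (Finite (exp (Re l) * (2 * 0 * exp 0)))%R by (f_equal; ring).
  apply is_lim_seq_mult'; [apply is_lim_seq_const|].
  apply is_lim_seq_mult'.
  + apply is_lim_seq_mult'; [apply is_lim_seq_const | exact hu].
  + apply is_lim_seq_continuous; [|exact hu].
    apply derivable_continuous_pt, derivable_pt_exp.
- exists 0%nat; intros n _.
  replace (u n) with (l + (u n - l)) at 1 by ring.
  rewrite Cexp_plus.
  replace (Cexp l * Cexp (u n - l) - Cexp l) with (Cexp l * (Cexp (u n - l) - 1)) by ring.
  rewrite Cmod_mult, Cmod_Cexp; apply Rmult_le_compat_l; [left; apply exp_pos|].
  apply Cexp_sub_1_bound.
Qed.

Lemma cos_eq_1 (t : R) : cos t = 1%R -> - (2 * PI) < t < 2 * PI -> t = 0%R.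
Proof.
intros h ht.
assert (hs : sin (t / 2) = 0%R).
{ replace t with (2 * (t / 2))%R in h by field.
  rewrite cos_2a_sin in h; nra. }
apply Rle_antisym; apply Rnot_lt_le; intro hlt.
- assert (0 < sin (t / 2)) by (apply sin_gt_0; lra); lra.
- assert (0 < sin (- (t / 2))) by (apply sin_gt_0; lra).
  rewrite sin_neg in *; lra.
Qed.

(** Two logarithms of the same number differ by a multiple of [2 * PI * i]; closeness of the
    imaginary parts forces that multiple to be 0.  Every identity between principal
    logarithms below is obtained in this way. *)
Lemma Cexp_inj_near (a b : C) :
  Cexp a = Cexp b -> Rabs (Im a - Im b) < 2 * PI -> a = b.
Proof.
intros h hi.
assert (h1 : Cexp (a - b) = 1)
  by (rewrite Cexp_minus, h; field; apply Cexp_neq_0).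
assert (hr : Re (a - b) = 0%R).
{ apply exp_inv; rewrite <- Cmod_Cexp, h1, Cmod_1, exp_0; reflexivity. }
assert (hc : cos (Im a - Im b) = 1%R).
{ apply (f_equal Re) in h1.
  change (exp (Re (a - b)) * cos (Im (a - b)) = 1)%R in h1.
  now rewrite hr, exp_0, Rmult_1_l, Im_minus in h1. }
apply Rabs_def2 in hi.
apply cos_eq_1 in hc; [|lra].
rewrite Re_minus in hr.
destruct a as [a1 a2], b as [b1 b2]; unfold Re, Im in *; simpl in *; f_equal; lra.
Qed.

(** * Complex series *)

Fixpoint Csum (u : nat -> C) (n : nat) : C :=
  match n with
  | O => 0
  | S k => Csum u k + u k
  end.

Definition CSeries (u : nat -> C) : C :=
  (Series (fun m => Re (u m)), Series (fun m => Im (u m))).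

Lemma sum_n_Csum (u : nat -> C) (n : nat) : sum_n u n = Csum u (S n).
Proof.
induction n as [|n IH]; [rewrite sum_O; simpl; ring|].
rewrite sum_Sn, IH; reflexivity.
Qed.

Lemma Re_Csum (u : nat -> C) (n : nat) : Re (Csum u (S n)) = sum_n (fun m => Re (u m)) n.
Proof.
induction n as [|n IH]; [rewrite sum_O; simpl; unfold Re; simpl; ring|].
rewrite sum_Sn, <- IH; reflexivity.
Qed.

Lemma Im_Csum (u : nat -> C) (n : nat) : Im (Csum u (S n)) = sum_n (fun m => Im (u m)) n.
Proof.
induction n as [|n IH]; [rewrite sum_O; simpl; unfold Im; simpl; ring|].
rewrite sum_Sn, <- IH; reflexivity.
Qed.

Lemma Csum_cv (u : nat -> C) (M : nat -> R) :
  (forall m, Cmod (u m) <= M m) -> ex_series M -> Ccv (Csum u) (CSeries u).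
Proof.
intros hu hM; apply Ccv_incr, Ccv_of_re_im.
- apply (is_lim_seq_ext (sum_n (fun m => Re (u m)))); [intros n; symmetry; apply Re_Csum|].
  apply Series_correct, (ex_series_le (V := R_CompleteNormedModule) _ M); [|exact hM].
  intros m; eapply Rle_trans; [apply re_le_Cmod | apply hu].
- apply (is_lim_seq_ext (sum_n (fun m => Im (u m)))); [intros n; symmetry; apply Im_Csum|].
  apply Series_correct, (ex_series_le (V := R_CompleteNormedModule) _ M); [|exact hM].
  intros m; eapply Rle_trans; [apply im_le_Cmod | apply hu].
Qed.

Lemma is_series_of_Ccv (u : nat -> C) (l : C) : Ccv (Csum u) l -> is_series u l.
Proof.
intros h; apply Ccv_incr in h; unfold is_series.
apply filterlim_locally; intros eps.
apply is_lim_seq_spec in h; destruct (h eps) as [N hN]; exists N; intros n hn.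
apply C_NormedModule_mixin_compat1.
specialize (hN n hn); rewrite sum_n_Csum.
rewrite Rminus_0_r, Rabs_pos_eq in hN by apply Cmod_ge_0; exact hN.
Qed.

Lemma CSeries_bound (u : nat -> C) (K : R) (M : nat -> R) :
  0 <= K -> (forall m, 0 <= M m) -> (forall m, Cmod (u m) <= K * M m) -> ex_series M ->
  Cmod (CSeries u) <= K * Series M.
Proof.
intros hK hp hu hM.
assert (hs : forall n, sum_n M n <= Series M).
{ apply (is_lim_seq_incr_compare (sum_n M)).
  - exact (Series_correct M hM).
  - intros n; rewrite sum_Sn; specialize (hp (S n)); unfold plus; simpl; lra. }
assert (h : forall n, Cmod (Csum u (S n)) <= K * sum_n M n).
{ induction n as [|n IH].
  - rewrite sum_O; simpl; rewrite Cplus_0_l; apply hu.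
  - rewrite sum_Sn; change (Csum u (S (S n))) with (Csum u (S n) + u (S n)).
    eapply Rle_trans; [apply Cmod_triangle|]; unfold plus; simpl; specialize (hu (S n)); simpl in *; lra. }
apply (Ccv_bound (fun n => Csum u (S n))).
- apply (proj1 (Ccv_incr _ _)), (Csum_cv u (fun m => K * M m)%R hu).
  apply (ex_series_scal_l (V := R_NormedModule) K M hM).
- intros n; eapply Rle_trans; [apply h|]; now apply Rmult_le_compat_l.
Qed.

(** * Term-by-term differentiation *)

(** A first-order Taylor expansion of [g] at [s], with slope [l], whose remainder is
    quadratic with constant [M] on a disk.  Bounding the values and the slope by the same [M]
    makes the notion stable under products.  A series of such functions with summable
    constants again has such an expansion, which replaces Weierstrass' theorem on limits of
    holomorphic functions. *)
Definition jet_bound (g : C -> C) (l s : C) (rho M : R) : Prop :=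
  Cmod l <= M /\
  forall h, Cmod h <= rho ->
    Cmod (g (s + h)) <= M /\ Cmod (g (s + h) - g s - h * l) <= M * Cmod h ^ 2.

Lemma jet_bound_ge_0 g l s rho M : jet_bound g l s rho M -> 0 <= M.
Proof. intros [h _]; eapply Rle_trans; [apply Cmod_ge_0 | exact h]. Qed.

Lemma jet_bound_at g l s rho M : 0 <= rho -> jet_bound g l s rho M -> Cmod (g s) <= M.
Proof.
intros hr [_ h]; destruct (h 0) as [h0 _]; [rewrite Cmod_0; lra|].
now rewrite Cplus_0_r in h0.
Qed.

Lemma jet_bound_le g l s rho M M' : M <= M' -> jet_bound g l s rho M -> jet_bound g l s rho M'.
Proof.
intros hM [hl h]; split; [lra|]; intros k hk; destruct (h k hk) as [h1 h2].
pose proof (pow2_ge_0 (Cmod k)); split; [lra | nra].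
Qed.

Lemma jet_bound_ext g g' l s rho M :
  (forall z, g z = g' z) -> jet_bound g l s rho M -> jet_bound g' l s rho M.
Proof.
intros e [hl h]; split; [exact hl|]; intros k hk; rewrite <- !e; now apply h.
Qed.

Lemma jet_bound_plus g g' l l' s rho M M' :
  jet_bound g l s rho M -> jet_bound g' l' s rho M' ->
  jet_bound (fun z => g z + g' z) (l + l') s rho (M + M').
Proof.
intros [hl h] [hl' h']; split.
- eapply Rle_trans; [apply Cmod_triangle|]; lra.
- intros k hk; destruct (h k hk) as [h1 h2]; destruct (h' k hk) as [h1' h2']; split.
  + eapply Rle_trans; [apply Cmod_triangle|]; lra.
  + replace (g (s + k) + g' (s + k) - (g s + g' s) - k * (l + l'))
      with ((g (s + k) - g s - k * l) + (g' (s + k) - g' s - k * l')) by ring.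
    eapply Rle_trans; [apply Cmod_triangle|]; lra.
Qed.

Lemma jet_bound_scal c g l s rho M :
  jet_bound g l s rho M -> jet_bound (fun z => c * g z) (c * l) s rho (Cmod c * M).
Proof.
intros [hl h]; pose proof (Cmod_ge_0 c); split.
- rewrite Cmod_mult; now apply Rmult_le_compat_l.
- intros k hk; destruct (h k hk) as [h1 h2]; split.
  + rewrite Cmod_mult; now apply Rmult_le_compat_l.
  + replace (c * g (s + k) - c * g s - k * (c * l))
      with (c * (g (s + k) - g s - k * l)) by ring.
    rewrite Cmod_mult, Rmult_assoc; now apply Rmult_le_compat_l.
Qed.

(** The remainder of a product splits as
    [(g(s+h) - g - h l) g'(s+h) + h l (g'(s+h) - g') + g (g'(s+h) - g' - h l')], of sizes
    [M M' h^2], [2 M M' h^2] and [M M' h^2]. *)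
Lemma jet_bound_mult g g' l l' s rho M M' :
  0 <= rho <= 1 -> jet_bound g l s rho M -> jet_bound g' l' s rho M' ->
  jet_bound (fun z => g z * g' z) (l * g' s + g s * l') s rho (4 * (M * M')).
Proof.
intros hr H H'; pose proof (jet_bound_ge_0 _ _ _ _ _ H) as hM; pose proof (jet_bound_ge_0 _ _ _ _ _ H') as hM'.
pose proof (jet_bound_at _ _ _ _ _ (proj1 hr) H) as hg; pose proof (jet_bound_at _ _ _ _ _ (proj1 hr) H') as hg'.
destruct H as [hl h], H' as [hl' h'].
assert (hp : forall a b A B, Cmod a <= A -> Cmod b <= B -> Cmod (a * b) <= A * B).
{ intros a b A B ha hb; rewrite Cmod_mult; apply Rmult_le_compat; auto using Cmod_ge_0. }
assert (hMM : 0 <= M * M') by now apply Rmult_le_pos.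
split.
- eapply Rle_trans; [apply Cmod_triangle|].
  pose proof (hp _ _ _ _ hl hg'); pose proof (hp _ _ _ _ hg hl'); lra.
- intros k hk; destruct (h k hk) as [h1 h2]; destruct (h' k hk) as [h1' h2']; split.
  + pose proof (hp _ _ _ _ h1 h1'); lra.
  + pose proof (Cmod_ge_0 k) as k0.
    assert (hd : Cmod (g' (s + k) - g' s) <= 2 * M' * Cmod k).
    { replace (g' (s + k) - g' s) with ((g' (s + k) - g' s - k * l') + k * l') by ring.
      eapply Rle_trans; [apply Cmod_triangle|].
      pose proof (hp k l' _ _ (Rle_refl _) hl').
      assert (M' * Cmod k ^ 2 <= M' * Cmod k)
        by (apply Rmult_le_compat_l; [exact hM' | nra]). lra. }
    replace (g (s + k) * g' (s + k) - g s * g' s - k * (l * g' s + g s * l'))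
      with ((g (s + k) - g s - k * l) * g' (s + k)
            + (k * l * (g' (s + k) - g' s) + g s * (g' (s + k) - g' s - k * l'))) by ring.
    eapply Rle_trans; [apply Cmod_triangle|].
    pose proof (Cmod_triangle (k * l * (g' (s + k) - g' s)) (g s * (g' (s + k) - g' s - k * l'))) as t1.
    pose proof (hp _ _ _ _ h2 h1') as t2.
    pose proof (hp _ _ _ _ (hp k l _ _ (Rle_refl _) hl) hd) as t3.
    pose proof (hp _ _ _ _ hg h2') as t4.
    eapply Rle_trans; [apply Rplus_le_compat; [exact t2 | eapply Rle_trans; [exact t1|]; apply Rplus_le_compat; [exact t3|exact t4]]|].
    right; ring.
Qed.

Lemma jet_bound_is_derive g l s rho M : 0 < rho -> jet_bound g l s rho M -> is_derive g s l.
Proof.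
intros hr H; pose proof (jet_bound_ge_0 _ _ _ _ _ H) as hM; destruct H as [_ h].
split; [apply is_linear_scal_l|].
intros x hx eps; apply (is_filter_lim_locally_unique (V := AbsRing_NormedModule C_AbsRing)) in hx; subst x.
assert (hd : 0 < Rmin rho (eps / (M + 1))).
{ apply Rmin_pos; [exact hr|]; apply Rdiv_lt_0_compat; [apply cond_pos | lra]. }
cut (forall y : C, Cmod (y - s) < Rmin rho (eps / (M + 1)) ->
       Cmod (g y - g s - (y - s) * l) <= eps * Cmod (y - s)).
{ intros key; exists (mkposreal _ hd); exact key. }
intros y hy.
destruct (h (y - s)) as [_ h2].
{ left; eapply Rlt_le_trans; [exact hy | apply Rmin_l]. }
replace (s + (y - s)) with y in h2 by ring.
eapply Rle_trans; [exact h2|].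
assert (h3 : Cmod (y - s) < eps / (M + 1)) by (eapply Rlt_le_trans; [exact hy | apply Rmin_r]).
pose proof (Cmod_ge_0 (y - s)).
assert (Cmod (y - s) * (M + 1) < eps).
{ apply Rmult_lt_compat_r with (r := (M + 1)%R) in h3; [|lra].
  replace (eps / (M + 1) * (M + 1))%R with (pos eps) in h3 by (field; lra); exact h3. }
simpl; rewrite Rmult_1_r, <- Rmult_assoc.
apply Rmult_le_compat_r; [assumption | nra].
Qed.

Lemma jet_bound_series (g : nat -> C -> C) (l : nat -> C) (s : C) (rho : R) (M : nat -> R) :
  0 <= rho -> (forall m, jet_bound (g m) (l m) s rho (M m)) -> ex_series M ->
  jet_bound (fun z => CSeries (fun m => g m z)) (CSeries l) s rho (Series M).
Proof.
intros hr H hM.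
assert (hp : forall m, 0 <= M m) by (intros m; exact (jet_bound_ge_0 _ _ _ _ _ (H m))).
split.
- rewrite <- (Rmult_1_l (Series M)); apply CSeries_bound; auto; [lra|].
  intros m; rewrite Rmult_1_l; apply H.
- intros h hh; split.
  + rewrite <- (Rmult_1_l (Series M)); apply CSeries_bound; auto; [lra|].
    intros m; rewrite Rmult_1_l; now apply H.
  + replace (CSeries (fun m => g m (s + h)) - CSeries (fun m => g m s) - h * CSeries l)
      with (CSeries (fun m => g m (s + h) - g m s - h * l m)).
    * rewrite Rmult_comm; apply CSeries_bound; auto; [apply pow2_ge_0|].
      intros m; rewrite Rmult_comm; now apply H.
    * apply (Ccv_unique (Csum (fun m => g m (s + h) - g m s - h * l m))).
      -- apply (Csum_cv _ (fun m => Cmod h ^ 2 * M m)%R).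
         ++ intros m; rewrite Rmult_comm; now apply H.
         ++ apply (ex_series_scal_l (V := R_NormedModule) (Cmod h ^ 2)%R M hM).
      -- apply (Ccv_ext (fun n => Csum (fun m => g m (s + h)) n
             + ((RtoC (-1)) * Csum (fun m => g m s) n + (- h) * Csum l n))).
         { induction n as [|n IH]; simpl; [ring|].
           rewrite <- IH; ring. }
         replace (CSeries (fun m => g m (s + h)) - CSeries (fun m => g m s) - h * CSeries l)
           with (CSeries (fun m => g m (s + h))
             + ((RtoC (-1)) * CSeries (fun m => g m s) + (- h) * CSeries l)) by ring.
         apply Ccv_plus; [|apply Ccv_plus; apply Ccv_scal].
         ++ apply (Csum_cv _ M); [intros m; now apply H | exact hM].
         ++ apply (Csum_cv _ M); [intros m; exact (jet_bound_at _ _ _ _ _ hr (H m)) | exact hM].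
         ++ apply (Csum_cv _ M); [intros m; now apply H | exact hM].
Qed.

(** The expansion follows from the one of [exp (- h L)] at [h = 0], after factoring out
    [exp (- s L)]; keeping [exp (- Re (s L))] exact preserves the decay in [L]. *)
Lemma jet_bound_exp (L s : C) (rho : R) :
  0 <= rho <= 1 ->
  jet_bound (fun z => Cexp (- (z * L))) (- L * Cexp (- (s * L))) s rho
    (4 * exp (- Re (s * L)) * (1 + Cmod L ^ 2) * exp (rho * Cmod L)).
Proof.
intros hr; pose proof (Cmod_ge_0 L) as h0.
set (X := Cmod L) in *; set (e0 := exp (- Re (s * L))).
assert (he0 : 0 < e0) by apply exp_pos.
assert (hm : Cmod (Cexp (- (s * L))) = e0).
{ rewrite Cmod_Cexp; unfold e0; f_equal; destruct (s * L); reflexivity. }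
assert (hx : 1 <= exp (rho * X)).
{ rewrite <- exp_0; apply exp_le; apply Rmult_le_pos; lra. }
assert (q1 : 0 < e0 * exp (rho * X)) by (apply Rmult_lt_0_compat; lra).
assert (q2 : 0 <= X ^ 2) by apply pow2_ge_0.
replace (4 * e0 * (1 + X ^ 2) * exp (rho * X))%R
  with (4 * (1 + X ^ 2) * (e0 * exp (rho * X)))%R by ring.
assert (q3 : e0 <= e0 * exp (rho * X)) by nra.
split; [|intros h hh; split].
- rewrite Cmod_mult, Cmod_opp, hm; fold X.
  apply Rle_trans with (X * (e0 * exp (rho * X)))%R.
  + apply Rmult_le_compat_l; lra.
  + apply Rmult_le_compat_r; [lra | nra].
- replace (- ((s + h) * L)) with (- (s * L) + - (h * L)) by ring.
  rewrite Cexp_plus, Cmod_mult, hm.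
  apply Rle_trans with (1 * (e0 * exp (rho * X)))%R.
  + rewrite Rmult_1_l; apply Rmult_le_compat_l; [lra|].
    eapply Rle_trans; [apply Cmod_Cexp_le|]; apply exp_le.
    rewrite Cmod_opp, Cmod_mult; now apply Rmult_le_compat_r.
  + apply Rmult_le_compat_r; [lra | nra].
- replace (- ((s + h) * L)) with (- (s * L) + - (h * L)) by ring.
  rewrite Cexp_plus.
  replace (Cexp (- (s * L)) * Cexp (- (h * L)) - Cexp (- (s * L)) - h * (- L * Cexp (- (s * L))))
    with (Cexp (- (s * L)) * (Cexp (- (h * L)) - 1 - (- (h * L)))) by ring.
  rewrite Cmod_mult, hm.
  apply Rle_trans with (e0 * (4 * (Cmod h * X) ^ 2 * exp (rho * X)))%R.
  + apply Rmult_le_compat_l; [lra|].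
    eapply Rle_trans; [apply Cexp_sub_linear_bound|].
    rewrite Cmod_opp, Cmod_mult; fold X.
    apply Rmult_le_compat_l.
    * pose proof (pow2_ge_0 (Cmod h * X)); lra.
    * apply exp_le; now apply Rmult_le_compat_r.
  + replace (e0 * (4 * (Cmod h * X) ^ 2 * exp (rho * X)))%R
      with (4 * X ^ 2 * (e0 * exp (rho * X)) * Cmod h ^ 2)%R by ring.
    apply Rmult_le_compat_r; [apply pow2_ge_0|].
    apply Rmult_le_compat_r; lra.
Qed.

(** Removing the constant and linear terms of [exp (- z a)] leaves something quadratic in [a],
    uniformly for [z] near [s].  This is the gain from a second difference. *)
Lemma jet_bound_exp_remainder (a s : C) (rho : R) :
  0 <= rho <= 1 ->
  jet_bound (fun z => Cexp (- (z * a)) - 1 + z * a) (- a * (Cexp (- (s * a)) - 1)) s rho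
    (4 * (Cmod s + 1) ^ 2 * exp ((Cmod s + 1) * Cmod a) * Cmod a ^ 2).
Proof.
intros hr; pose proof (Cmod_ge_0 a) as h0; pose proof (Cmod_ge_0 s) as hs0.
set (X := Cmod a) in *; set (R1 := (Cmod s + 1)%R).
assert (hR : 1 <= R1) by (unfold R1; lra).
assert (q2 : 0 <= X ^ 2) by apply pow2_ge_0.
assert (hex : 0 < exp (R1 * X)) by apply exp_pos.
assert (hse : exp (Cmod s * X) <= exp (R1 * X)) by (apply exp_le; unfold R1; nra).
split; [|intros h hh; split].
- rewrite Cmod_mult, Cmod_opp; fold X.
  apply Rle_trans with (X * (2 * (Cmod s * X) * exp (R1 * X)))%R.
  + apply Rmult_le_compat_l; [lra|].
    eapply Rle_trans; [apply Cexp_sub_1_bound|]; rewrite Cmod_opp, Cmod_mult; fold X.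
    apply Rmult_le_compat_l; [nra | exact hse].
  + replace (X * (2 * (Cmod s * X) * exp (R1 * X)))%R
      with (2 * Cmod s * exp (R1 * X) * X ^ 2)%R by ring.
    apply Rmult_le_compat_r; [lra|]; apply Rmult_le_compat_r; [lra|]; unfold R1; nra.
- replace (Cexp (- ((s + h) * a)) - 1 + (s + h) * a)
    with (Cexp (- ((s + h) * a)) - 1 - (- ((s + h) * a))) by ring.
  eapply Rle_trans; [apply Cexp_sub_linear_bound|]; rewrite Cmod_opp, Cmod_mult; fold X.
  assert (hb : Cmod (s + h) <= R1)
    by (eapply Rle_trans; [apply Cmod_triangle|]; unfold R1; lra).
  pose proof (Cmod_ge_0 (s + h)).
  replace (4 * R1 ^ 2 * exp (R1 * X) * X ^ 2)%R
    with (4 * (R1 * X) ^ 2 * exp (R1 * X))%R by ring.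
  assert (Cmod (s + h) * X <= R1 * X) by (apply Rmult_le_compat_r; lra).
  apply Rmult_le_compat.
  + pose proof (pow2_ge_0 (Cmod (s + h) * X)); lra.
  + left; apply exp_pos.
  + apply Rmult_le_compat_l; [lra|]; apply pow_incr; split; [now apply Rmult_le_pos | assumption].
  + now apply exp_le.
- replace (- ((s + h) * a)) with (- (s * a) + - (h * a)) by ring.
  rewrite Cexp_plus.
  replace (Cexp (- (s * a)) * Cexp (- (h * a)) - 1 + (s + h) * a
      - (Cexp (- (s * a)) - 1 + s * a) - h * (- a * (Cexp (- (s * a)) - 1)))
    with (Cexp (- (s * a)) * (Cexp (- (h * a)) - 1 - (- (h * a)))) by ring.
  rewrite Cmod_mult.
  apply Rle_trans with (exp (Cmod s * X) * (4 * (Cmod h * X) ^ 2 * exp (1 * X)))%R.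
  + apply Rmult_le_compat; [apply Cmod_ge_0 | apply Cmod_ge_0 | |].
    * eapply Rle_trans; [apply Cmod_Cexp_le|]; rewrite Cmod_opp, Cmod_mult; apply Rle_refl.
    * eapply Rle_trans; [apply Cexp_sub_linear_bound|]; rewrite Cmod_opp, Cmod_mult; fold X.
      apply Rmult_le_compat_l.
      -- pose proof (pow2_ge_0 (Cmod h * X)); lra.
      -- apply exp_le, Rmult_le_compat_r; lra.
  + replace (exp (Cmod s * X) * (4 * (Cmod h * X) ^ 2 * exp (1 * X)))%R
      with (4 * exp (R1 * X) * X ^ 2 * Cmod h ^ 2)%R.
    2:{ replace (R1 * X)%R with (Cmod s * X + 1 * X)%R by (unfold R1; ring).
        rewrite exp_plus; ring. }
    apply Rmult_le_compat_r; [apply pow2_ge_0|].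
    apply Rmult_le_compat_r; [lra|]; apply Rmult_le_compat_r; [lra|]; nra.
Qed.

Lemma jet_bound_linear (a s : C) (rho : R) :
  0 <= rho <= 1 -> jet_bound (fun z => - (z * a)) (- a) s rho ((Cmod s + 1) * Cmod a).
Proof.
intros hr; pose proof (Cmod_ge_0 a); pose proof (Cmod_ge_0 s).
split; [|intros h hh; split].
- rewrite Cmod_opp; nra.
- rewrite Cmod_opp, Cmod_mult; apply Rmult_le_compat_r; [assumption|].
  eapply Rle_trans; [apply Cmod_triangle|]; lra.
- replace (- ((s + h) * a) - - (s * a) - h * - a) with (RtoC 0) by ring.
  rewrite Cmod_0; apply Rmult_le_pos; [nra | apply pow2_ge_0].
Qed.

(** * Euler's transformation *)

Definition second_diff (f : nat -> C) (m : nat) : C := f m - 2 * f (S m) + f (S (S m)).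

Definition altsum (f : nat -> C) (n : nat) : C := Csum (fun m => RtoC (-1) ^ m * f m) n.

(** Given summable second differences, this is the alternating sum of [f] if [f] tends to 0,
    and a regularized value of the divergent sum if [f] grows slowly. *)
Definition euler_sum (f : nat -> C) : C :=
  f O / 2 + (f O - f 1%nat) / 4 + / 4 * CSeries (fun m => RtoC (-1) ^ m * second_diff f m).

Lemma Cmod_sign (m : nat) : Cmod (RtoC (-1) ^ m) = 1%R.
Proof.
rewrite Cmod_pow, Cmod_R; replace (Rabs (-1)) with 1%R by (rewrite Rabs_left; lra).
apply pow1.
Qed.

(** Both steps of Euler's transformation at once, with the boundary terms of the partial sums. *)
Lemma altsum_euler (f : nat -> C) (n : nat) :
  altsum f n + RtoC (-1) ^ n * (f n / 2 + (f n - f (S n)) / 4)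
  = f O / 2 + (f O - f 1%nat) / 4 + / 4 * Csum (fun m => RtoC (-1) ^ m * second_diff f m) n.
Proof.
unfold altsum; induction n as [|n IH]; [simpl; field|].
replace (f O / 2 + (f O - f 1%nat) / 4 + / 4 * Csum (fun m => RtoC (-1) ^ m * second_diff f m) (S n))
  with (f O / 2 + (f O - f 1%nat) / 4 + / 4 * Csum (fun m => RtoC (-1) ^ m * second_diff f m) n
        + / 4 * (RtoC (-1) ^ n * second_diff f n)) by (simpl; ring).
rewrite <- IH; unfold second_diff; simpl; field.
Qed.

Lemma euler_cv (f : nat -> C) (M : nat -> R) :
  (forall m, Cmod (second_diff f m) <= M m) -> ex_series M ->
  Ccv (fun n => altsum f n + RtoC (-1) ^ n * (f n / 2 + (f n - f (S n)) / 4)) (euler_sum f).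
Proof.
intros h hM.
eapply Ccv_ext; [intros n; symmetry; apply altsum_euler|].
apply Ccv_plus; [apply Ccv_const|]; apply Ccv_scal, (Csum_cv _ M); [|exact hM].
intros m; rewrite Cmod_mult, Cmod_sign, Rmult_1_l; apply h.
Qed.

(** * Logarithm-like sequences *)

Definition bigO (u : nat -> C) (v : nat -> R) : Prop :=
  exists c, forall m, Cmod (u m) <= c * v m.

(** A bound from some index on suffices: the constant can be enlarged to absorb the finitely
    many other indices because [v] does not vanish. *)
Lemma bigO_eventually (u : nat -> C) (v : nat -> R) (c : R) (N : nat) :
  (forall m, 0 < v m) -> (forall m, (N <= m)%nat -> Cmod (u m) <= c * v m) -> bigO u v.
Proof.
intros hv; revert c; induction N as [|N IH]; intros c h.
- exists c; intros m; apply h; lia.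
- apply (IH (Rmax c (Cmod (u N) / v N))); intros m hm.
  destruct (Nat.eq_dec m N) as [->|hne].
  + apply Rle_trans with (Cmod (u N) / v N * v N)%R.
    * right; field; specialize (hv N); lra.
    * apply Rmult_le_compat_r; [left; apply hv | apply Rmax_r].
  + eapply Rle_trans; [apply h; lia|].
    apply Rmult_le_compat_r; [left; apply hv | apply Rmax_l].
Qed.

Lemma bigO_eq_eventually (u u' : nat -> C) (v : nat -> R) (N : nat) :
  (forall m, 0 < v m) -> (forall m, (N <= m)%nat -> u m = u' m) -> bigO u v -> bigO u' v.
Proof.
intros hv e [c h]; apply (bigO_eventually _ _ c N hv).
intros m hm; rewrite <- e by exact hm; apply h.
Qed.

Lemma bigO_plus (u u' : nat -> C) (v : nat -> R) :
  bigO u v -> bigO u' v -> bigO (fun m => u m + u' m) v.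
Proof.
intros [c h] [c' h']; exists (c + c')%R; intros m.
eapply Rle_trans; [apply Cmod_triangle|].
rewrite Rmult_plus_distr_r; now apply Rplus_le_compat.
Qed.

Lemma bigO_ext (u u' : nat -> C) (v : nat -> R) :
  (forall m, u m = u' m) -> bigO u v -> bigO u' v.
Proof. intros e [c h]; exists c; intros m; rewrite <- e; apply h. Qed.

Definition recip (m : nat) : R := (/ (INR m + 1))%R.

Lemma recip_pos (m : nat) : 0 < recip m.
Proof. apply Rinv_0_lt_compat; pose proof (pos_INR m); lra. Qed.

Lemma recip_le (m : nat) : recip (S m) <= recip m.
Proof.
unfold recip; rewrite S_INR; pose proof (pos_INR m); apply Rinv_le_contravar; lra.
Qed.

Lemma is_lim_recip : is_lim_seq recip 0%R.
Proof.
apply (is_lim_seq_ext (fun n => / INR (S n))%R).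
- intros n; unfold recip; now rewrite S_INR.
- apply (is_lim_seq_incr_1 (fun n => / INR n)%R).
  apply (is_lim_seq_inv INR p_infty); [apply is_lim_seq_INR | discriminate].
Qed.

Lemma bigO_recip_cv (u : nat -> C) : bigO u recip -> Ccv u 0.
Proof.
intros [c h]; apply (Ccv_squeeze _ _ (fun n => c * recip n)%R).
- replace (Finite 0) with (Finite (c * 0)%R) by (f_equal; ring).
  apply is_lim_seq_mult'; [apply is_lim_seq_const | apply is_lim_recip].
- exists 0%nat; intros n _; replace (u n - 0) with (u n) by ring; apply h.
Qed.

(** Of order [m ^ (-3/2)]: two powers of decay come from the second difference, and half a
    power is lost to [exp (- s * L m)] when [Re s] is slightly negative. *)
Definition weight (m : nat) : R := (sqrt (INR m + 2) * recip m ^ 2)%R.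

(** Comparison with the telescoping series of differences of [1 / sqrt (m + 1)]. *)
Lemma weight_summable : ex_series weight.
Proof.
set (t := fun m => (/ sqrt (INR m + 1))%R).
assert (h0 : is_series (fun m => t m - t (S m))%R (t 0%nat)).
{ unfold is_series.
  apply (filterlim_ext (fun n => t 0%nat - t (S n))%R).
  - induction x as [|n IH]; [now rewrite sum_O|].
    rewrite sum_Sn, <- IH; unfold plus; simpl; ring.
  - change (is_lim_seq (fun n => t 0%nat - t (S n))%R (t 0%nat)).
    replace (Finite (t 0%nat)) with (Finite (t 0%nat - 0)%R) by (f_equal; ring).
    apply is_lim_seq_minus'; [apply is_lim_seq_const|].
    apply (is_lim_seq_incr_1 t).
    apply (is_lim_seq_inv (fun m => sqrt (INR m + 1))%R p_infty); [|discriminate].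
    apply (is_lim_comp_seq sqrt (fun m => INR m + 1)%R p_infty p_infty).
    + apply (is_lim_sqrt_p (fun x => x)), is_lim_id.
    + exists 0%nat; discriminate.
    + apply (is_lim_seq_ext (fun n => INR (S n))); [intros n; apply S_INR|].
      apply (is_lim_seq_incr_1 INR), is_lim_seq_INR. }
assert (h1 : ex_series (fun m => 12 * (t m - t (S m)))%R)
  by (apply (ex_series_scal_l (V := R_NormedModule) 12%R); now exists (t 0%nat)).
apply (ex_series_le (V := R_CompleteNormedModule) weight _) with (2 := h1).
intros m; unfold weight, recip, t; rewrite S_INR.
pose proof (pos_INR m) as hm.
replace (INR m + 1 + 1)%R with (INR m + 2)%R by ring.
set (a := sqrt (INR m + 1)); set (b := sqrt (INR m + 2)).
assert (ha : (a * a = INR m + 1)%R) by (apply sqrt_sqrt; lra).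
assert (hb : (b * b = INR m + 2)%R) by (apply sqrt_sqrt; lra).
assert (ha0 : 0 < a) by (apply sqrt_lt_R0; lra).
assert (hb0 : 0 < b) by (apply sqrt_lt_R0; lra).
(* [t m - t (S m) = 1 / (a b (a + b))], and [b <= 2 a] bounds the weight by 12 times this. *)
assert (hab : b <= 2 * a) by nra.
rewrite <- ha.
change (Rabs (b * (/ (a * a)) ^ 2) <= 12 * (/ a - / b)).
rewrite Rabs_pos_eq.
2:{ apply Rmult_le_pos; [lra | apply pow2_ge_0]. }
assert (e : (/ a - / b = / (a * b * (a + b)))%R).
{ replace (/ a - / b)%R with ((b * b - a * a) / (a * b * (a + b)))%R by (field; lra).
  rewrite ha, hb; field; lra. }
rewrite e.
apply Rmult_le_reg_r with (a * a * a * a * b * (a + b))%R.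
{ repeat apply Rmult_lt_0_compat; lra. }
replace (b * (/ (a * a)) ^ 2 * (a * a * a * a * b * (a + b)))%R
  with (b * b * (a + b))%R by (field; lra).
replace (12 * / (a * b * (a + b)) * (a * a * a * a * b * (a + b)))%R
  with (12 * (a * a * a))%R by (field; lra).
assert (b * b <= 4 * (a * a)) by nra.
apply Rle_trans with (4 * (a * a) * (3 * a))%R; [|right; ring].
apply Rmult_le_compat; nra.
Qed.

Definition LogLike (d : R) (L : nat -> C) : Prop :=
  bigO (fun m => L m - RtoC (d * ln (INR m + 1))) (fun _ => 1%R) /\
  bigO (fun m => L (S m) - L m) recip /\
  bigO (second_diff L) (fun m => recip m ^ 2)%R.

Lemma LogLike_bound (d : R) (L : nat -> C) :
  LogLike d L -> exists c, 1 <= c /\ forall m,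
    Cmod (L m - RtoC (d * ln (INR m + 1))) <= c /\
    Cmod (L (S m) - L m) <= c * recip m /\ Cmod (second_diff L m) <= c * recip m ^ 2.
Proof.
intros [[c1 h1] [[c2 h2] [c3 h3]]].
exists (Rmax 1 (Rmax c1 (Rmax c2 c3))); split; [apply Rmax_l|]; intros m.
assert (e1 : c1 <= Rmax 1 (Rmax c1 (Rmax c2 c3)))
  by (eapply Rle_trans; [|apply Rmax_r]; apply Rmax_l).
assert (e2 : c2 <= Rmax 1 (Rmax c1 (Rmax c2 c3)))
  by (eapply Rle_trans; [|apply Rmax_r]; eapply Rle_trans; [|apply Rmax_r]; apply Rmax_l).
assert (e3 : c3 <= Rmax 1 (Rmax c1 (Rmax c2 c3)))
  by (eapply Rle_trans; [|apply Rmax_r]; eapply Rle_trans; [|apply Rmax_r]; apply Rmax_r).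
pose proof (recip_pos m) as hp.
repeat split.
- specialize (h1 m); simpl in h1; lra.
- eapply Rle_trans; [apply h2|]; apply Rmult_le_compat_r; lra.
- eapply Rle_trans; [apply h3|]; apply Rmult_le_compat_r; [apply pow2_ge_0 | lra].
Qed.

Lemma LogLike_eventually (d : R) (L L' : nat -> C) (N : nat) :
  (forall m, (N <= m)%nat -> L m = L' m) -> LogLike d L -> LogLike d L'.
Proof.
intros e [h1 [h2 h3]]; repeat split.
- revert h1; apply (bigO_eq_eventually _ _ _ N); [intros; lra|].
  intros m hm; now rewrite e.
- revert h2; apply (bigO_eq_eventually _ _ _ N); [apply recip_pos|].
  intros m hm; rewrite !e by lia; reflexivity.
- revert h3; apply (bigO_eq_eventually _ _ _ N).
  + intros m; apply pow_lt, recip_pos.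
  + intros m hm; unfold second_diff; rewrite !e by lia; reflexivity.
Qed.

Lemma LogLike_plus (d d' : R) (L L' : nat -> C) :
  LogLike d L -> LogLike d' L' -> LogLike (d + d') (fun m => L m + L' m).
Proof.
intros [h1 [h2 h3]] [h1' [h2' h3']]; repeat split.
- apply (bigO_ext (fun m => (L m - RtoC (d * ln (INR m + 1)))
                           + (L' m - RtoC (d' * ln (INR m + 1))))).
  + intros m; rewrite Rmult_plus_distr_r, RtoC_plus; ring.
  + now apply bigO_plus.
- apply (bigO_ext (fun m => (L (S m) - L m) + (L' (S m) - L' m))); [intros m; ring|].
  now apply bigO_plus.
- apply (bigO_ext (fun m => second_diff L m + second_diff L' m)); [intros m; unfold second_diff; ring|].
  now apply bigO_plus.
Qed.

(** * Analytic continuation of alternating zeta series *)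

Definition zterm (L : nat -> C) (s : C) (m : nat) : C := Cexp (- (s * L m)).
Definition dzterm (L : nat -> C) (s : C) (m : nat) : C := - L m * Cexp (- (s * L m)).

(** Absorbs the polynomial factors that come from differentiating in [s] into a slightly larger
    exponential. *)
Lemma quadratic_le_exp (rho X : R) :
  0 < rho -> 0 <= X -> (1 + X ^ 2) <= (1 + 4 / rho ^ 2) * exp (rho * X).
Proof.
intros hr hX.
set (y := (rho * X)%R).
assert (hy : 0 <= y) by (unfold y; nra).
assert (h1 : 1 + y / 2 <= exp (y / 2)) by apply exp_ineq1_le.
assert (h2 : exp y = (exp (y / 2) * exp (y / 2))%R) by (rewrite <- exp_plus; f_equal; field).
assert (h3 : 1 <= exp y) by nra.
assert (h4 : y ^ 2 <= 4 * exp y) by nra.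
replace (X ^ 2)%R with (/ rho ^ 2 * y ^ 2)%R by (unfold y; field; lra).
assert (0 < / rho ^ 2) by (apply Rinv_0_lt_compat, pow_lt, hr).
unfold Rdiv; nra.
Qed.

(** The two smallness conditions say that [Re s >= - 1 / (4 d)] and [rho <= 1 / (8 d)].  Then
    [exp (- s L)] costs a quarter power of [m], and the two factors [exp (rho |L|)], one from the
    disk and one from the polynomial terms, together cost another quarter. *)
Lemma jet_bound_zterm_growth (d : R) (L : nat -> C) (s : C) (rho c : R) :
  0 < d -> 0 < rho <= 1 -> 8 * (rho * d) <= 1 -> - (1) <= 4 * (d * Re s) ->
  (forall m, Cmod (L m - RtoC (d * ln (INR m + 1))) <= c) ->
  exists K, forall m,
    jet_bound (fun z => zterm L z m) (dzterm L s m) s rho (K * sqrt (INR m + 1)).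
Proof.
intros hd hr hrd hs hL.
exists (4 * (1 + 4 / rho ^ 2) * exp (Cmod s * c + 2 * rho * c))%R; intros m.
eapply jet_bound_le; [|apply jet_bound_exp; lra].
set (X := Cmod (L m)); set (l := ln (INR m + 1)).
assert (hl : 0 <= l).
{ unfold l; rewrite <- ln_1; pose proof (pos_INR m).
  destruct (Req_dec (INR m) 0) as [e|e]; [rewrite e, Rplus_0_l; lra|].
  left; apply ln_increasing; lra. }
assert (hX : X <= d * l + c).
{ unfold X; replace (L m) with ((L m - RtoC (d * l)) + RtoC (d * l)) by ring.
  eapply Rle_trans; [apply Cmod_triangle|].
  rewrite Cmod_R, Rabs_pos_eq by nra; specialize (hL m); fold l in hL; lra. }
assert (hre : - Re (s * L m) <= l / 4 + Cmod s * c).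
{ replace (s * L m) with (s * RtoC (d * l) + s * (L m - RtoC (d * l))) by ring.
  replace (- Re (s * RtoC (d * l) + s * (L m - RtoC (d * l))))%R
    with (- (Re s * (d * l)) - Re (s * (L m - RtoC (d * l))))%R.
  2:{ set (w := L m - RtoC (d * l)); destruct s, w; unfold Re, RtoC; simpl; ring. }
  pose proof (re_le_Cmod (s * (L m - RtoC (d * l)))) as h; rewrite Cmod_mult in h.
  apply Rabs_le_between in h.
  assert (Cmod s * Cmod (L m - RtoC (d * l)) <= Cmod s * c)
    by (apply Rmult_le_compat_l; [apply Cmod_ge_0 | apply hL]).
  assert (- (1) * l <= 4 * (d * Re s) * l) by (apply Rmult_le_compat_r; lra).
  lra. }
assert (hX0 : 0 <= X) by apply Cmod_ge_0.
apply Rle_trans with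
  (4 * exp (- Re (s * L m)) * ((1 + 4 / rho ^ 2) * exp (rho * X)) * exp (rho * X))%R.
{ apply Rmult_le_compat_r; [left; apply exp_pos|].
  apply Rmult_le_compat_l; [pose proof (exp_pos (- Re (s * L m))); lra|].
  apply quadratic_le_exp; lra. }
replace (4 * exp (- Re (s * L m)) * ((1 + 4 / rho ^ 2) * exp (rho * X)) * exp (rho * X))%R
  with (4 * (1 + 4 / rho ^ 2) * exp (- Re (s * L m) + (rho * X + rho * X)))%R
  by (rewrite !exp_plus; ring).
rewrite Rmult_assoc; rewrite (Rmult_assoc (4 * _)).
assert (h4 : 0 < 1 + 4 / rho ^ 2).
{ assert (0 < / rho ^ 2) by (apply Rinv_0_lt_compat, pow_lt; lra). unfold Rdiv; lra. }
rewrite <- Rmult_assoc.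
apply Rmult_le_compat_l; [lra|].
replace (sqrt (INR m + 1)) with (exp (l / 2)).
2:{ rewrite <- (exp_ln (sqrt (INR m + 1))).
    - f_equal; unfold l. pose proof (pos_INR m).
      rewrite <- (sqrt_sqrt (INR m + 1)) at 1 by lra.
      rewrite ln_mult by (apply sqrt_lt_R0; lra); field.
    - apply sqrt_lt_R0; pose proof (pos_INR m); lra. }
rewrite <- exp_plus; apply exp_le.
assert (rho * X <= rho * (d * l + c)) by (apply Rmult_le_compat_l; lra).
assert (8 * (rho * d) * l <= 1 * l) by (apply Rmult_le_compat_r; lra).
lra.
Qed.

(** With [a = L m - L (m + 1)] and [b = L (m + 2) - L (m + 1)], the second difference of
    [exp (- s L)] is [exp (- s L (m + 1))] times [exp (- s a) + exp (- s b) - 2].  The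
    quadratic remainders are [O(1 / m^2)] because [a] and [b] are [O(1 / m)], and the linear
    part involves only [a + b], the second difference of [L]. *)
Lemma zterm_second_diff (L : nat -> C) (s : C) (m : nat) :
  second_diff (zterm L s) m =
  zterm L s (S m) * ((Cexp (- (s * (L m - L (S m)))) - 1 + s * (L m - L (S m)))
    + ((Cexp (- (s * (L (S (S m)) - L (S m)))) - 1 + s * (L (S (S m)) - L (S m)))
       + - (s * second_diff L m))).
Proof.
unfold zterm, second_diff.
replace (Cexp (- (s * L m))) with (Cexp (- (s * L (S m))) * Cexp (- (s * (L m - L (S m)))))
  by (rewrite <- Cexp_plus; f_equal; ring).
replace (Cexp (- (s * L (S (S m)))))
  with (Cexp (- (s * L (S m))) * Cexp (- (s * (L (S (S m)) - L (S m)))))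
  by (rewrite <- Cexp_plus; f_equal; ring).
ring.
Qed.

Lemma dzterm_second_diff (L : nat -> C) (s : C) (m : nat) :
  second_diff (dzterm L s) m =
  dzterm L s (S m) * ((Cexp (- (s * (L m - L (S m)))) - 1 + s * (L m - L (S m)))
    + ((Cexp (- (s * (L (S (S m)) - L (S m)))) - 1 + s * (L (S (S m)) - L (S m)))
       + - (s * second_diff L m)))
  + zterm L s (S m) * (- (L m - L (S m)) * (Cexp (- (s * (L m - L (S m)))) - 1)
    + (- (L (S (S m)) - L (S m)) * (Cexp (- (s * (L (S (S m)) - L (S m)))) - 1)
       + - second_diff L m)).
Proof.
unfold zterm, dzterm, second_diff.
replace (Cexp (- (s * L m))) with (Cexp (- (s * L (S m))) * Cexp (- (s * (L m - L (S m)))))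
  by (rewrite <- Cexp_plus; f_equal; ring).
replace (Cexp (- (s * L (S (S m)))))
  with (Cexp (- (s * L (S m))) * Cexp (- (s * (L (S (S m)) - L (S m)))))
  by (rewrite <- Cexp_plus; f_equal; ring).
ring.
Qed.

Lemma jet_bound_zterm_second_diff (d : R) (L : nat -> C) (s : C) (rho : R) :
  LogLike d L -> 0 < d -> 0 < rho <= 1 -> 8 * (rho * d) <= 1 -> - (1) <= 4 * (d * Re s) ->
  exists K, forall m,
    jet_bound (fun z => second_diff (zterm L z) m) (second_diff (dzterm L s) m) s rho (K * weight m).
Proof.
intros hL hd hr hrd hs.
destruct (LogLike_bound d L hL) as [c [hc hb]].
destruct (jet_bound_zterm_growth d L s rho c hd hr hrd hs) as [K hK]; [intros m; apply hb|].
set (R1 := (Cmod s + 1)%R).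
set (B := (2 * (4 * R1 ^ 2 * exp (R1 * c) * c ^ 2) + R1 * c)%R).
exists (4 * (K * B))%R; intros m.
assert (hR1 : 1 <= R1) by (unfold R1; pose proof (Cmod_ge_0 s); lra).
assert (hw0 : 0 < recip m) by apply recip_pos.
assert (hw1 : recip m <= 1).
{ unfold recip; rewrite <- Rinv_1; pose proof (pos_INR m); apply Rinv_le_contravar; lra. }
assert (hrem : forall a, Cmod a <= c * recip m ->
  jet_bound (fun z => Cexp (- (z * a)) - 1 + z * a) (- a * (Cexp (- (s * a)) - 1)) s rho
    (4 * R1 ^ 2 * exp (R1 * c) * c ^ 2 * recip m ^ 2)).
{ intros a ha; eapply jet_bound_le; [|apply jet_bound_exp_remainder; lra]; fold R1.
  pose proof (Cmod_ge_0 a).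
  assert (hac : Cmod a <= c) by nra.
  rewrite (Rmult_assoc _ (c ^ 2)).
  apply Rmult_le_compat.
  - apply Rmult_le_pos; [nra | left; apply exp_pos].
  - apply pow2_ge_0.
  - apply Rmult_le_compat_l; [nra|]; apply exp_le; nra.
  - rewrite <- Rpow_mult_distr; apply pow_incr; lra. }
destruct (hb m) as [_ [h1 h2]]; destruct (hb (S m)) as [_ [h3 _]].
assert (ha : Cmod (L m - L (S m)) <= c * recip m)
  by (replace (L m - L (S m)) with (- (L (S m) - L m)) by ring; now rewrite Cmod_opp).
assert (ha' : Cmod (L (S (S m)) - L (S m)) <= c * recip m).
{ eapply Rle_trans; [exact h3|]; apply Rmult_le_compat_l; [lra | apply recip_le]. }
assert (hlin : jet_bound (fun z => - (z * second_diff L m)) (- second_diff L m) s rho (R1 * (c * recip m ^ 2))).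
{ eapply jet_bound_le; [|apply jet_bound_linear; lra]; fold R1; apply Rmult_le_compat_l; lra. }
pose proof (jet_bound_mult _ _ _ _ _ _ _ _ (conj (Rlt_le _ _ (proj1 hr)) (proj2 hr)) (hK (S m))
  (jet_bound_plus _ _ _ _ _ _ _ _ (hrem _ ha) (jet_bound_plus _ _ _ _ _ _ _ _ (hrem _ ha') hlin))) as H.
rewrite dzterm_second_diff; eapply jet_bound_ext; [intros z; symmetry; apply zterm_second_diff|].
eapply jet_bound_le; [|exact H]; right.
unfold weight, B; rewrite S_INR.
replace (INR m + 1 + 1)%R with (INR m + 2)%R by ring; ring.
Qed.

Lemma jet_bound_euler_sum (d : R) (L : nat -> C) (s : C) (rho : R) :
  LogLike d L -> 0 < d -> 0 < rho <= 1 -> 8 * (rho * d) <= 1 -> - (1) <= 4 * (d * Re s) ->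
  exists M, jet_bound (fun z => euler_sum (zterm L z)) (euler_sum (dzterm L s)) s rho M.
Proof.
intros hL hd hr hrd hs.
destruct (jet_bound_zterm_second_diff d L s rho hL hd hr hrd hs) as [K hK].
assert (h0 := jet_bound_exp (L 0%nat) s rho ltac:(lra)).
assert (h1 := jet_bound_exp (L 1%nat) s rho ltac:(lra)).
pose proof (jet_bound_series (fun m z => RtoC (-1) ^ m * second_diff (zterm L z) m)
  (fun m => RtoC (-1) ^ m * second_diff (dzterm L s) m) s rho (fun m => K * weight m)%R) as h2.
eexists; unfold euler_sum.
eapply jet_bound_ext; [|replace (dzterm L s O / 2 + (dzterm L s O - dzterm L s 1%nat) / 4)
  with ((3 / 4) * dzterm L s O + (- / 4) * dzterm L s 1%nat) by field;
  apply jet_bound_plus; [apply jet_bound_plus; apply jet_bound_scal; [exact h0 | exact h1]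
                   | apply jet_bound_scal, h2]].
- intros z; unfold zterm; simpl; field.
- lra.
- intros m; rewrite <- (Rmult_1_l (K * weight m)), <- (Cmod_sign m).
  apply (jet_bound_scal (RtoC (-1) ^ m)), hK.
- apply (ex_series_scal_l (V := R_NormedModule) K weight weight_summable).
Qed.

(** The partial alternating sum with half of the next term; the half term cancels the
    oscillation that the partial sums of a slowly growing sequence have. *)
Definition regularized_log_sum (L : nat -> C) (n : nat) : C :=
  altsum L n + RtoC (-1) ^ n * (L n / 2).

Lemma regularized_log_sum_cv (d : R) (L : nat -> C) :
  LogLike d L -> Ccv (regularized_log_sum L) (euler_sum L).
Proof.
intros hL; destruct (LogLike_bound d L hL) as [c [_ hb]].
assert (h1 : ex_series (fun m => c * recip m ^ 2)%R).
{ apply (ex_series_scal_l (V := R_NormedModule) c (fun m => recip m ^ 2)%R).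
  apply (ex_series_le (V := R_CompleteNormedModule) _ weight); [|apply weight_summable].
  intros m; unfold weight; change (Rabs (recip m ^ 2) <= sqrt (INR m + 2) * recip m ^ 2).
  rewrite Rabs_pos_eq by apply pow2_ge_0.
  rewrite <- (Rmult_1_l (recip m ^ 2)) at 1; apply Rmult_le_compat_r; [apply pow2_ge_0|].
  rewrite <- sqrt_1; apply sqrt_le_1_alt; pose proof (pos_INR m); lra. }
pose proof (euler_cv L _ (fun m => proj2 (proj2 (hb m))) h1) as h2.
assert (h3 : Ccv (fun n => RtoC (-1) ^ n * (/ 4 * (L (S n) - L n))) 0).
{ apply (Ccv_of_bounded_decay _ _ 1); [intros n; rewrite Cmod_sign; lra|].
  replace (RtoC 0) with (/ 4 * 0) by ring.
  apply Ccv_scal, bigO_recip_cv, hL. }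
pose proof (Ccv_plus _ _ _ _ h2 h3) as h4; rewrite Cplus_0_r in h4.
revert h4; apply Ccv_ext; intros n; unfold regularized_log_sum; field.
Qed.

Lemma zterm_decay (d : R) (L : nat -> C) (s : C) :
  LogLike d L -> 0 < d -> 0 < Re s -> Ccv (zterm L s) 0.
Proof.
intros hL hd hs; destruct (LogLike_bound d L hL) as [c [_ hb]].
apply (Ccv_squeeze _ _ (fun n => exp (Cmod s * c) * exp (- (Re s * d * ln (INR n + 1))))%R).
- replace (Finite 0) with (Finite (exp (Cmod s * c) * 0)%R) by (f_equal; ring).
  apply is_lim_seq_mult'; [apply is_lim_seq_const|].
  apply (is_lim_comp_seq exp _ m_infty 0%R); [apply is_lim_exp_m | exists 0%nat; discriminate|].
  apply (is_lim_seq_ext (fun n => (- (Re s * d)) * ln (INR n + 1))%R); [intros n; ring|].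
  replace m_infty with (Rbar_mult (- (Re s * d))%R p_infty).
  + apply is_lim_seq_scal_l.
    apply (is_lim_comp_seq ln _ p_infty p_infty); [apply is_lim_ln_p | exists 0%nat; discriminate|].
    apply (is_lim_seq_ext (fun n => INR (S n))); [intros n; apply S_INR|].
    apply (is_lim_seq_incr_1 INR), is_lim_seq_INR.
  + assert (0 < Re s * d) by (apply Rmult_lt_0_compat; assumption).
    simpl; destruct (Rle_dec 0 (- (Re s * d))) as [h|h]; [exfalso; lra | reflexivity].
- exists 0%nat; intros n _; replace (zterm L s n - 0) with (zterm L s n) by ring.
  unfold zterm; rewrite Cmod_Cexp, <- exp_plus; apply exp_le.
  destruct (hb n) as [h _]; set (t := (d * ln (INR n + 1))%R) in *.
  replace (Re (- (s * L n))) with (- (Re s * t) - Re (s * (L n - RtoC t)))%R.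
  2:{ destruct s, (L n); unfold Re, RtoC; simpl; ring. }
  pose proof (re_le_Cmod (s * (L n - RtoC t))) as h1; rewrite Cmod_mult in h1.
  apply Rabs_le_between in h1.
  assert (Cmod s * Cmod (L n - RtoC t) <= Cmod s * c)
    by (apply Rmult_le_compat_l; [apply Cmod_ge_0 | exact h]).
  unfold t in *; lra.
Qed.

Lemma CSeries_ext (u v : nat -> C) : (forall m, u m = v m) -> CSeries u = CSeries v.
Proof. intros e; unfold CSeries; f_equal; apply Series_ext; intros m; now rewrite e. Qed.

Lemma CSeries_opp (u : nat -> C) : CSeries (fun m => - u m) = - CSeries u.
Proof. unfold CSeries, Copp at 3; simpl; f_equal; apply Series_opp. Qed.

Lemma euler_sum_opp (f g : nat -> C) :
  (forall m, g m = - f m) -> euler_sum g = - euler_sum f.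
Proof.
intros e; unfold euler_sum; rewrite !e.
replace (CSeries (fun m => RtoC (-1) ^ m * second_diff g m))
  with (- CSeries (fun m => RtoC (-1) ^ m * second_diff f m)); [field|].
rewrite <- CSeries_opp; apply CSeries_ext; intros m; unfold second_diff; rewrite !e; ring.
Qed.

(** The continuation is [euler_sum] of the terms, which agrees with the series for [Re s > 0]
    because there the boundary terms of Euler's transformation tend to 0. *)
Theorem zeta_reg_value_LogLike (d : R) (L : nat -> C) (p : nat -> C -> C) (P : C) :
  LogLike d L -> 0 < d -> (forall m s, p m s = Cexp (- (s * L m))) ->
  Ccv (fun n => Cexp (regularized_log_sum L n)) P -> zeta_reg_value p P.
Proof.
intros hL hd hp hP.
(* One number serves as radius of the disk of continuation and as radius of the expansions. *)
set (r := (/ (8 * d + 1))%R).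
assert (hr : 0 < r <= 1).
{ unfold r; split; [apply Rinv_0_lt_compat; lra|].
  rewrite <- Rinv_1; apply Rinv_le_contravar; lra. }
assert (hrd : 8 * (r * d) <= 1).
{ apply Rmult_le_reg_r with (8 * d + 1)%R; [lra|].
  unfold r; replace (8 * (/ (8 * d + 1) * d) * (8 * d + 1))%R with (8 * d)%R by (field; lra); lra. }
assert (hder : forall s, 0 < Re s \/ Cmod s < r ->
  is_derive (fun z => euler_sum (zterm L z)) s (euler_sum (dzterm L s))).
{ intros s hs.
  destruct (jet_bound_euler_sum d L s r hL hd hr hrd) as [M hM].
  - destruct hs as [hs|hs]; [nra|].
    pose proof (re_le_Cmod s) as h; apply Rabs_le_between in h; nra.
  - exact (jet_bound_is_derive _ _ _ _ _ (proj1 hr) hM). }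
exists (fun z => euler_sum (zterm L z)), r; split; [lra|]; split; [|split].
- intros s hs.
  destruct (jet_bound_zterm_second_diff d L s r hL hd hr hrd) as [K hK]; [nra|].
  assert (h1 : ex_series (fun m => K * weight m)%R)
    by apply (ex_series_scal_l (V := R_NormedModule) K weight weight_summable).
  pose proof (euler_cv (zterm L s) _ (fun m => jet_bound_at _ _ _ _ _ (Rlt_le _ _ (proj1 hr)) (hK m)) h1) as h2.
  assert (h3 : Ccv (fun n => (- (RtoC (-1) ^ n)) *
     (zterm L s n * (3 / 4) - zterm L s (S n) / 4)) 0).
  { apply (Ccv_of_bounded_decay _ _ 1); [intros n; rewrite Cmod_opp, Cmod_sign; lra|].
    pose proof (zterm_decay d L s hL hd hs) as h4.
    pose proof (proj1 (Ccv_incr _ _) h4) as h5.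
    apply (Ccv_scal _ (3 / 4)) in h4; apply (Ccv_scal _ (- / 4)) in h5.
    pose proof (Ccv_plus _ _ _ _ h4 h5) as h6.
    replace (RtoC 0) with (3 / 4 * 0 + - / 4 * 0) by ring.
    revert h6; apply Ccv_ext; intros n; field. }
  apply is_series_of_Ccv.
  pose proof (Ccv_plus _ _ _ _ h2 h3) as h4; rewrite Cplus_0_r in h4.
  revert h4; apply Ccv_ext; intros n.
  transitivity (altsum (zterm L s) n); [field|].
  unfold altsum; induction n as [|n IH]; [reflexivity|].
  simpl; rewrite IH, hp; reflexivity.
- intros s hs; exists (euler_sum (dzterm L s)); now apply hder.
- rewrite (is_C_derive_unique _ _ (euler_sum (dzterm L 0)))
    by (apply hder; right; rewrite Cmod_0; lra).
  apply (Ccv_unique _ _ _ hP).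
  rewrite (euler_sum_opp L).
  + replace (- - euler_sum L) with (euler_sum L) by ring; apply Ccv_Cexp, (regularized_log_sum_cv d L hL).
  + intros m; unfold dzterm; replace (- (0 * L m)) with (RtoC 0) by ring.
    rewrite Cexp_0; ring.
Qed.

(** * The principal logarithm *)

Lemma neq_0_of_Re_pos (z : C) : 0 < Re z -> z <> 0.
Proof. intros h ->; simpl in h; lra. Qed.

Lemma Carg_polar (z : C) :
  z <> 0 -> Re z = (Cmod z * cos (Carg z))%R /\ Im z = (Cmod z * sin (Carg z))%R.
Proof.
intros hz; pose proof (Cexp_Clog z hz) as e.
apply Cmod_gt_0 in hz; unfold Cexp, Clog in e; simpl in e; rewrite exp_ln in e by exact hz.
split; [exact (eq_sym (f_equal Re e)) | exact (eq_sym (f_equal Im e))].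
Qed.

Lemma Carg_right_half_plane (z : C) : 0 < Re z -> - (PI / 2) < Carg z < PI / 2.
Proof.
intros h; pose proof (neq_0_of_Re_pos z h) as hz.
destruct (Carg_polar z hz) as [e _]; apply Cmod_gt_0 in hz.
assert (hc : 0 < cos (Carg z)) by (apply Rnot_le_lt; intro; nra).
pose proof (Carg_bounds z) as hb; split; apply Rnot_le_lt; intro hle.
- assert (cos (- Carg z) <= 0) by (apply cos_le_0; lra); rewrite cos_neg in *; lra.
- assert (cos (Carg z) <= 0) by (apply cos_le_0; lra); lra.
Qed.

Lemma Rabs_atan_le (x : R) : Rabs (atan x) <= Rabs x.
Proof.
destruct (MVT_gen atan 0 x (fun t => / (1 + t ^ 2))%R) as [c [_ e]].
- intros t _; auto_derive; [trivial | field; nra].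
- intros t _; apply derivable_continuous_pt, derivable_pt_atan.
- rewrite atan_0, !Rminus_0_r in e; rewrite e, Rabs_mult.
  rewrite <- (Rmult_1_l (Rabs x)) at 2; apply Rmult_le_compat_r; [apply Rabs_pos|].
  pose proof (pow2_ge_0 c).
  rewrite Rabs_pos_eq by (left; apply Rinv_0_lt_compat; lra).
  rewrite <- Rinv_1; apply Rinv_le_contravar; lra.
Qed.

(** In the right half-plane the argument is [atan (Im z / Re z)]. *)
Lemma Carg_le (z : C) : 0 < Re z -> Rabs (Carg z) <= Rabs (Im z) / Re z.
Proof.
intros h; pose proof (neq_0_of_Re_pos z h) as hz.
destruct (Carg_polar z hz) as [er ei]; pose proof (Carg_right_half_plane z h) as hb.
apply Cmod_gt_0 in hz.
assert (hc : 0 < cos (Carg z)) by (apply cos_gt_0; lra).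
rewrite <- (Rabs_pos_eq (Re z)) by lra; rewrite <- Rabs_div by lra.
replace (Carg z) with (atan (Im z / Re z)) at 1; [apply Rabs_atan_le|].
rewrite er, ei.
replace (Cmod z * sin (Carg z) / (Cmod z * cos (Carg z)))%R with (tan (Carg z))
  by (unfold tan; field; lra).
apply atan_tan; lra.
Qed.

Lemma Clog_mult (a b : C) :
  0 < Re a -> 0 < Re b -> Clog (a * b) = Clog a + Clog b.
Proof.
intros ha hb.
pose proof (neq_0_of_Re_pos a ha); pose proof (neq_0_of_Re_pos b hb).
apply Cexp_inj_near.
- rewrite Cexp_plus, !Cexp_Clog; auto using Cmult_neq_0.
- pose proof (Carg_right_half_plane a ha); pose proof (Carg_right_half_plane b hb).
  pose proof (Carg_bounds (a * b)).
  change (Rabs (Carg (a * b) - (Carg a + Carg b)) < 2 * PI).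
  apply Rabs_def1; lra.
Qed.

Lemma Clog_RtoC (t : R) : 0 < t -> Clog t = ln t.
Proof.
intros ht; unfold Clog; rewrite Cmod_R, Rabs_pos_eq by lra.
pose proof (Carg_le t ht) as h; simpl Im in h; rewrite Rabs_R0 in h.
unfold RtoC at 2; f_equal.
assert (e : Rabs (Carg t) = 0%R).
{ apply Rle_antisym; [unfold Rdiv in h; lra | apply Rabs_pos]. }
destruct (Req_dec (Carg t) 0) as [e0|e0]; [exact e0|].
now apply Rabs_no_R0 in e0.
Qed.

Lemma ln_le_sub_1 (x : R) : 0 < x -> ln x <= x - 1.
Proof. intros hx; pose proof (exp_ineq1_le (ln x)) as h; rewrite exp_ln in h; lra. Qed.

Lemma Re_1_plus (w : C) : Cmod w <= / 2 -> / 2 <= Re (1 + w).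
Proof.
intros hw; pose proof (re_le_Cmod w) as h; apply Rabs_le_between in h.
destruct w; unfold Re in *; simpl in *; lra.
Qed.

Lemma Clog_1_plus_small (w : C) : Cmod w <= / 2 -> Cmod (Clog (1 + w)) <= 4 * Cmod w.
Proof.
intros hw; pose proof (Re_1_plus w hw) as hr.
pose proof (Cmod_ge_0 w).
assert (h1 : Rabs (Carg (1 + w)) <= 2 * Cmod w).
{ eapply Rle_trans; [apply Carg_le; lra|].
  replace (Im (1 + w)) with (Im w) by (destruct w; unfold Im; simpl; ring).
  pose proof (im_le_Cmod w).
  apply Rmult_le_reg_r with (Re (1 + w)); [lra|].
  unfold Rdiv; rewrite Rmult_assoc, Rinv_l, Rmult_1_r by lra; nra. }
assert (hu : Cmod (1 + w) <= 1 + Cmod w).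
{ eapply Rle_trans; [apply Cmod_triangle|]; rewrite Cmod_1; lra. }
assert (hl : 1 - Cmod w <= Cmod (1 + w)).
{ pose proof (Cmod_sub_le (1 + w) w) as h; replace (1 + w - w) with (RtoC 1) in h by ring.
  rewrite Cmod_1 in h; lra. }
assert (h2 : Rabs (ln (Cmod (1 + w))) <= 2 * Cmod w).
{ apply Rabs_le; split.
  - assert (h3 : ln (/ Cmod (1 + w)) <= / Cmod (1 + w) - 1)
      by (apply ln_le_sub_1, Rinv_0_lt_compat; lra).
    rewrite ln_Rinv in h3 by lra.
    assert (/ Cmod (1 + w) <= 1 + 2 * Cmod w); [|lra].
    apply Rmult_le_reg_r with (Cmod (1 + w)); [lra|].
    rewrite Rinv_l by lra; nra.
  - eapply Rle_trans; [apply ln_le_sub_1; lra|]; lra. }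
eapply Rle_trans; [apply Cmod_le_abs|]; unfold Clog; simpl; lra.
Qed.

(** With [l = Clog (1 + w)], one has [w - l = exp l - 1 - l], which is quadratic in [l], and [l]
    is [O(w)]. *)
Lemma Clog_1_plus_quadratic (w : C) :
  Cmod w <= / 2 -> Cmod (Clog (1 + w) - w) <= 64 * exp 2 * Cmod w ^ 2.
Proof.
intros hw; pose proof (Re_1_plus w hw) as hr; pose proof (Cmod_ge_0 w).
pose proof (Clog_1_plus_small w hw) as hs.
set (l := Clog (1 + w)) in *.
assert (e : Cexp l = 1 + w) by (apply Cexp_Clog, neq_0_of_Re_pos; lra).
replace (l - w) with (- (Cexp l - 1 - l)) by (rewrite e; ring).
rewrite Cmod_opp; eapply Rle_trans; [apply Cexp_sub_linear_bound|].
pose proof (Cmod_ge_0 l).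
replace (64 * exp 2 * Cmod w ^ 2)%R with (4 * (4 * Cmod w) ^ 2 * exp 2)%R by ring.
apply Rmult_le_compat; [nra | left; apply exp_pos | nra | apply exp_le; lra].
Qed.

(** * Logarithms of shifted integers *)

Lemma exists_nat_ge (x : R) : exists N : nat, forall m, (N <= m)%nat -> x <= INR m.
Proof.
destruct (INR_unbounded x) as [N hN]; exists N; intros m hm.
apply le_INR in hm; lra.
Qed.

(** Collects what the later estimates need from large [m]: [m + z] lies well inside the right
    half-plane and [1 / (m + z)] is small enough for the expansion of [Clog (1 + w)]. *)
Lemma shift_far (z : C) : exists N, forall m, (N <= m)%nat ->
  2 <= Re (INR m + z) /\ Cmod (/ (INR m + z)) <= 2 * recip m /\ 2 * recip m <= / 2.
Proof.
(* [m >= 2 |z| + 5] gives both [Re (m + z) >= (m + 1) / 2] and [m >= 5]. *)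
destruct (exists_nat_ge (2 * Cmod z + 5)) as [N hN]; exists N; intros m hm.
specialize (hN m hm).
pose proof (re_le_Cmod z) as h; apply Rabs_le_between in h.
pose proof (Cmod_ge_0 z).
assert (e : Re (INR m + z) = (INR m + Re z)%R) by (destruct z; unfold Re, RtoC; simpl; ring).
assert (h2 : (INR m + 1) / 2 <= Re (INR m + z)) by lra.
split; [lra|]; split.
- rewrite Cmod_inv by (apply neq_0_of_Re_pos; lra).
  assert (hc : (INR m + 1) / 2 <= Cmod (INR m + z)).
  { eapply Rle_trans; [exact h2|]; eapply Rle_trans; [apply Rle_abs | apply re_le_Cmod]. }
  unfold recip; replace (2 * / (INR m + 1))%R with (/ ((INR m + 1) / 2))%R by (field; lra).
  apply Rinv_le_contravar; lra.
- unfold recip; apply Rmult_le_reg_r with (INR m + 1)%R; [lra|].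
  rewrite Rmult_assoc, Rinv_l by lra; lra.
Qed.

Lemma Clog_shift_succ (z : C) : exists N, forall m, (N <= m)%nat ->
  Clog (INR (S m) + z) - Clog (INR m + z) = Clog (1 + / (INR m + z)).
Proof.
destruct (shift_far z) as [N hN]; exists N; intros m hm.
destruct (hN m hm) as [h1 [h2 h3]].
assert (hz : INR m + z <> 0) by (apply neq_0_of_Re_pos; lra).
rewrite S_INR, RtoC_plus.
replace (INR m + 1 + z) with ((INR m + z) * (1 + / (INR m + z))) by (field; exact hz).
rewrite Clog_mult; [ring | lra |].
eapply Rlt_le_trans; [|apply Re_1_plus]; lra.
Qed.

Lemma Clog_shift_asymp (z : C) :
  bigO (fun m => Clog (INR m + z) - RtoC (ln (INR m + 1))) recip.
Proof.
destruct (exists_nat_ge (2 * Cmod (z - 1))) as [N hN].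
apply (bigO_eventually _ _ (4 * Cmod (z - 1)) N); [apply recip_pos|].
intros m hm; specialize (hN m hm); pose proof (pos_INR m).
set (w := RtoC (recip m) * (z - 1)).
assert (hne : RtoC (INR m) + 1 <> 0).
{ rewrite <- RtoC_plus; intro e; apply RtoC_inj in e; lra. }
assert (hw : Cmod w = (recip m * Cmod (z - 1))%R).
{ unfold w; rewrite Cmod_mult, Cmod_R, Rabs_pos_eq; [reflexivity | left; apply recip_pos]. }
assert (hw2 : Cmod w <= / 2).
{ rewrite hw; unfold recip; apply Rmult_le_reg_l with (INR m + 1)%R; [lra|].
  rewrite <- Rmult_assoc, Rinv_r, Rmult_1_l by lra; lra. }
replace (INR m + z) with (RtoC (INR m + 1) * (1 + w)).
2:{ unfold w, recip; rewrite RtoC_inv, RtoC_plus by lra; field; exact hne. }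
rewrite Clog_mult, Clog_RtoC; [|lra|simpl; lra|].
2:{ eapply Rlt_le_trans; [|apply Re_1_plus; exact hw2]; lra. }
replace (ln (INR m + 1) + Clog (1 + w) - ln (INR m + 1)) with (Clog (1 + w)) by ring.
eapply Rle_trans; [apply Clog_1_plus_small, hw2|]; rewrite hw; lra.
Qed.

(** The increments are [Clog (1 + w_m)] with [w_m = 1 / (m + z)], hence [w_m + O(w_m ^ 2)], and
    [w_(m+1) - w_m = - w_m * w_(m+1)]. *)
Lemma LogLike_Clog_shift (z : C) : LogLike 1 (fun m => Clog (INR m + z)).
Proof.
destruct (shift_far z) as [N hN]; destruct (Clog_shift_succ z) as [N' hN'].
repeat split.
- destruct (Clog_shift_asymp z) as [c hc].
  exists (Rmax c 0); intros m; rewrite Rmult_1_l.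
  eapply Rle_trans; [apply hc|].
  assert (recip m <= 1).
  { unfold recip; rewrite <- Rinv_1; pose proof (pos_INR m); apply Rinv_le_contravar; lra. }
  pose proof (recip_pos m); pose proof (Rmax_l c 0); pose proof (Rmax_r c 0); nra.
- apply (bigO_eventually _ _ 8 (N + N')); [apply recip_pos|].
  intros m hm; rewrite hN' by lia; destruct (hN m ltac:(lia)) as [_ [h2 h3]].
  eapply Rle_trans; [apply Clog_1_plus_small; lra|]; lra.
- apply (bigO_eventually _ _ (4 + 2 * (64 * exp 2 * 4)) (N + N')).
  { intros m; apply pow_lt, recip_pos. }
  intros m hm; unfold second_diff.
  replace (Clog (INR m + z) - 2 * Clog (INR (S m) + z) + Clog (INR (S (S m)) + z))
    with ((Clog (INR (S (S m)) + z) - Clog (INR (S m) + z))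
          - (Clog (INR (S m) + z) - Clog (INR m + z))) by ring.
  rewrite !hN' by lia.
  destruct (hN m ltac:(lia)) as [h1 [h2 h3]].
  destruct (hN (S m) ltac:(lia)) as [h1' [h2' h3']].
  pose proof (recip_le m) as hl; pose proof (recip_pos m) as hp.
  assert (hz : INR m + z <> 0) by (apply neq_0_of_Re_pos; lra).
  assert (hz' : INR (S m) + z <> 0) by (apply neq_0_of_Re_pos; lra).
  set (w := / (INR m + z)) in *; set (w' := / (INR (S m) + z)) in *.
  assert (ew : w' - w = - (w * w')).
  { unfold w, w'; rewrite S_INR, RtoC_plus in *; field; split; assumption. }
  replace (Clog (1 + w') - Clog (1 + w))
    with ((w' - w) + ((Clog (1 + w') - w') - (Clog (1 + w) - w))) by ring.
  eapply Rle_trans; [apply Cmod_triangle|].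
  rewrite Rmult_plus_distr_r; apply Rplus_le_compat.
  + rewrite ew, Cmod_opp, Cmod_mult.
    replace (4 * recip m ^ 2)%R with ((2 * recip m) * (2 * recip m))%R by ring.
    apply Rmult_le_compat; auto using Cmod_ge_0; lra.
  + eapply Rle_trans; [apply Cmod_sub_le|].
    assert (q : forall v, Cmod v <= 2 * recip m ->
      Cmod (Clog (1 + v) - v) <= 64 * exp 2 * 4 * recip m ^ 2).
    { intros v hv; eapply Rle_trans; [apply Clog_1_plus_quadratic; lra|].
      pose proof (exp_pos 2).
      replace (64 * exp 2 * 4 * recip m ^ 2)%R with (64 * exp 2 * (2 * recip m) ^ 2)%R by ring.
      apply Rmult_le_compat_l; [lra|].
      apply pow_incr; split; [apply Cmod_ge_0 | exact hv]. }
    pose proof (q w h2); pose proof (q w' ltac:(lra)); lra.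
Qed.

(** * The alternating harmonic series *)

(** Taylor polynomials of [ln (1 + t)]. *)
Fixpoint mercator (n : nat) (t : R) : R :=
  match n with
  | O => 0%R
  | S k => (mercator k t + (- 1) ^ k * t ^ S k / INR (S k))%R
  end.

Lemma is_derive_mercator (n : nat) (t : R) :
  -1 < t -> is_derive (mercator n) t ((1 - (- t) ^ n) / (1 + t))%R.
Proof.
intros ht; induction n as [|n IH].
- simpl; replace ((1 - 1) / (1 + t))%R with 0%R by (field; lra).
  apply (is_derive_const (V := R_NormedModule)).
- replace ((1 - (- t) ^ S n) / (1 + t))%R
    with ((1 - (- t) ^ n) / (1 + t) + (- 1) ^ n * t ^ n)%R.
  2:{ replace (- t)%R with (-1 * t)%R by ring; rewrite !Rpow_mult_distr; simpl; field; lra. }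
  apply (is_derive_plus (V := R_NormedModule)); [exact IH|].
  pose proof (not_0_INR (S n) ltac:(lia)) as hn.
  auto_derive; [trivial|]. 
  replace (Nat.pred (S n)) with n by reflexivity.
  field. exact hn.
Qed.

(** The remainder of the Taylor polynomial has derivative [(- t) ^ n / (1 + t)], of absolute value at
    most [t ^ n] on [0, 1]. *)
Lemma ln2_sub_mercator (n : nat) : Rabs (ln 2 - mercator n 1) <= / (INR n + 1).
Proof.
set (phi := fun t => (ln (1 + t) - mercator n t)%R).
assert (hphi : forall t, -1 < t -> is_derive phi t ((- t) ^ n / (1 + t))%R).
{ intros t ht.
  replace ((- t) ^ n / (1 + t))%R with (/ (1 + t) - (1 - (- t) ^ n) / (1 + t))%R by (field; lra).
  apply (is_derive_minus (V := R_NormedModule)); [|now apply is_derive_mercator].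
  auto_derive; [lra | field; lra]. }
assert (h0 : phi 0%R = 0%R).
{ unfold phi; rewrite Rplus_0_r, ln_1.
  replace (mercator n 0) with 0%R; [ring|].
  clear; induction n as [|n IH]; [reflexivity|]; simpl; rewrite <- IH; unfold Rdiv; ring. }
assert (h1 : phi 1%R = (ln 2 - mercator n 1)%R) by (unfold phi; do 2 f_equal; ring).
rewrite <- h1.
assert (hpn : 0 < INR n + 1) by (pose proof (pos_INR n); lra).
assert (hq : forall sg, sg = 1%R \/ sg = (-1)%R -> sg * phi 1 <= / (INR n + 1)).
{ intros sg hsg.
  set (psi := fun t => (sg * phi t - t ^ S n / (INR n + 1))%R).
  destruct (MVT_gen psi 0 1 (fun t => sg * ((- t) ^ n / (1 + t)) - t ^ n)%R) as [c [hc e]].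
  - rewrite Rmin_left, Rmax_right by lra; intros t ht.
    apply (is_derive_minus (V := R_NormedModule)).
    + apply (is_derive_scal phi t sg); apply hphi; lra.
    + auto_derive; [trivial|].
      change (1 * (INR (S n) * t ^ n) * / (INR n + 1) = t ^ n)%R.
      rewrite S_INR; field; lra.
  - rewrite Rmin_left, Rmax_right by lra; intros t ht.
    apply continuity_pt_filterlim, (ex_derive_continuous psi t).
    unfold psi; apply (ex_derive_minus (V := R_NormedModule)).
    + apply (ex_derive_scal phi sg t); eexists; apply hphi; lra.
    + auto_derive; trivial.
  - rewrite Rmin_left, Rmax_right in hc by lra.
    assert (hle : sg * ((- c) ^ n / (1 + c)) <= c ^ n).
    { eapply Rle_trans; [apply Rle_abs|].
      unfold Rdiv; rewrite !Rabs_mult, <- RPow_abs, Rabs_Ropp, (Rabs_pos_eq c) by lra.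
      replace (Rabs sg) with 1%R
        by (destruct hsg as [-> | ->]; [rewrite Rabs_R1 | rewrite Rabs_left]; lra).
      assert (0 <= c ^ n) by (apply pow_le; lra).
      rewrite Rabs_pos_eq by (left; apply Rinv_0_lt_compat; lra).
      assert (/ (1 + c) <= 1) by (rewrite <- Rinv_1; apply Rinv_le_contravar; lra).
      nra. }
    unfold psi in e; rewrite h0, pow1, pow_i in e by lia.
    unfold Rdiv in e; lra. }
pose proof (hq 1%R ltac:(now left)); pose proof (hq (-1)%R ltac:(now right)).
apply Rabs_le; lra.
Qed.

Lemma altsum_recip_cv : Ccv (altsum (fun m => RtoC (recip m))) (RtoC (ln 2)).
Proof.
apply (Ccv_ext (fun n => RtoC (mercator n 1))).
- unfold altsum; induction n as [|n IH]; [reflexivity|].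
  change (RtoC (mercator n 1 + (- 1) ^ n * 1 ^ S n / INR (S n)) =
    Csum (fun m => RtoC (-1) ^ m * RtoC (recip m)) n + RtoC (-1) ^ n * RtoC (recip n)).
  rewrite <- IH, <- RtoC_pow, <- RtoC_mult, <- RtoC_plus.
  unfold recip; rewrite pow1, S_INR; f_equal; unfold Rdiv; ring.
- apply (Ccv_squeeze _ _ recip); [apply is_lim_recip|].
  exists 0%nat; intros n _; rewrite <- RtoC_minus, Cmod_R, Rabs_minus_sym.
  apply ln2_sub_mercator.
Qed.

(** * Wallis' formula *)

Definition wallis (n : nat) : R := RInt (fun t => sin t ^ n)%R 0 (PI / 2).

Lemma ex_RInt_sin_pow (n : nat) (a b : R) : ex_RInt (fun t => sin t ^ n)%R a b.
Proof.
apply (ex_RInt_continuous (V := R_CompleteNormedModule)); intros t _.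
apply (ex_derive_continuous (fun t => sin t ^ n)%R t); auto_derive; trivial.
Qed.

Lemma wallis_0 : wallis 0 = (PI / 2)%R.
Proof.
unfold wallis; rewrite (RInt_ext _ (fun _ => 1%R)) by (intros; reflexivity).
rewrite RInt_const; unfold scal; simpl; unfold mult; simpl; ring.
Qed.

Lemma wallis_1 : wallis 1 = 1%R.
Proof.
unfold wallis; apply is_RInt_unique.
replace 1%R with (minus ((fun t => - cos t) (PI / 2)) ((fun t => - cos t) 0))%R.
2:{ unfold minus, plus, opp; simpl; rewrite cos_PI2, cos_0; ring. }
apply (is_RInt_derive (V := R_CompleteNormedModule) (fun t => - cos t)%R).
- intros t _; auto_derive; [trivial | ring].
- intros t _; apply (ex_derive_continuous (fun t => sin t ^ 1)%R t); auto_derive; trivial.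
Qed.

(** Integration of the derivative of [- cos t * sin t ^ (n + 1)], which vanishes at both ends. *)
Lemma wallis_rec (n : nat) : (INR (S (S n)) * wallis (S (S n)) = INR (S n) * wallis n)%R.
Proof.
assert (h : is_RInt (fun t => INR (S (S n)) * sin t ^ S (S n) - INR (S n) * sin t ^ n)%R
              0 (PI / 2) 0%R).
{ replace 0%R with (minus ((fun t => - cos t * sin t ^ S n) (PI / 2))
                          ((fun t => - cos t * sin t ^ S n) 0))%R at 2.
  2:{ unfold minus, plus, opp; simpl; rewrite cos_PI2, sin_0; ring. }
  apply (is_RInt_derive (V := R_CompleteNormedModule) (fun t => - cos t * sin t ^ S n)%R).
  - intros t _; auto_derive; [trivial|].
    replace (Nat.pred (S n)) with n by reflexivity.
    pose proof (sin2_cos2 t) as e; unfold Rsqr in e.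
    rewrite (S_INR (S n)).
    replace (sin t ^ S (S n))%R with (sin t * sin t * sin t ^ n)%R by (simpl; ring).
    replace (sin t ^ S n)%R with (sin t * sin t ^ n)%R by (simpl; ring).
    change (match n with 0%nat => 1 | S _ => INR n + 1 end)%R with (INR (S n)).
    transitivity (sin t * sin t * sin t ^ n - INR (S n) * sin t ^ n * (cos t * cos t))%R.
    + ring.
    + replace (cos t * cos t)%R with (1 - sin t * sin t)%R by lra; ring.
  - intros t _.
    apply (ex_derive_continuous
      (fun t => INR (S (S n)) * sin t ^ S (S n) - INR (S n) * sin t ^ n)%R t).
    auto_derive; trivial. }
assert (h' : is_RInt (fun t => INR (S (S n)) * sin t ^ S (S n) - INR (S n) * sin t ^ n)%R
              0 (PI / 2) (INR (S (S n)) * wallis (S (S n)) - INR (S n) * wallis n)%R).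
{ apply (is_RInt_minus (V := R_NormedModule)); apply (is_RInt_scal (V := R_NormedModule));
    apply (RInt_correct (V := R_CompleteNormedModule)), ex_RInt_sin_pow. }
apply (is_RInt_unique (V := R_CompleteNormedModule)) in h; apply (is_RInt_unique (V := R_CompleteNormedModule)) in h'.
rewrite h in h'; lra.
Qed.

Lemma wallis_decr (n : nat) : wallis (S n) <= wallis n.
Proof.
unfold wallis; apply RInt_le; [pose proof PI_RGT_0; lra | | |]; try apply ex_RInt_sin_pow.
intros t ht; simpl.
assert (0 < sin t) by (apply sin_gt_0; pose proof PI_RGT_0; lra).
pose proof (SIN_bound t) as [_ h].
assert (0 <= sin t ^ n) by (apply pow_le; lra); nra.
Qed.

Lemma wallis_prod (n : nat) : (INR (S n) * (wallis n * wallis (S n)) = PI / 2)%R.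
Proof.
induction n as [|n IH].
- rewrite wallis_0, wallis_1; simpl; ring.
- rewrite <- IH.
  replace (INR (S (S n)) * (wallis (S n) * wallis (S (S n))))%R
    with (wallis (S n) * (INR (S (S n)) * wallis (S (S n))))%R by ring.
  rewrite wallis_rec; ring.
Qed.

Lemma wallis_pos (n : nat) : 0 < wallis n.
Proof.
assert (h : forall k, 0 <= wallis k).
{ intros k; unfold wallis; apply RInt_ge_0; [pose proof PI_RGT_0; lra | apply ex_RInt_sin_pow|].
  intros t ht; apply pow_le; left; apply sin_gt_0; pose proof PI_RGT_0; lra. }
pose proof (wallis_prod n) as e; pose proof PI_RGT_0.
destruct (h n) as [h1|h1]; [exact h1|]; rewrite <- h1 in e; lra.
Qed.

(** By monotonicity [wallis (n + 1) ^ 2] lies between the products of [wallis (n + 1)] with its two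
    neighbours, which are known exactly. *)
Lemma wallis_asymp : is_lim_seq (fun n => wallis n ^ 2 * (INR n + 1))%R (PI / 2)%R.
Proof.
apply is_lim_seq_incr_1.
apply (is_lim_seq_le_le (fun _ => PI / 2)%R _ (fun n => PI / 2 + PI / 2 * recip n)%R).
- intros n.
  pose proof (wallis_prod n) as e1; pose proof (wallis_prod (S n)) as e2.
  pose proof (wallis_decr n) as d1; pose proof (wallis_decr (S n)) as d2.
  pose proof (wallis_pos n); pose proof (wallis_pos (S n)); pose proof (wallis_pos (S (S n))).
  pose proof (pos_INR n).
  rewrite (S_INR (S n)) in e2; rewrite S_INR in *; unfold recip.
  set (w0 := wallis n) in *; set (w1 := wallis (S n)) in *; set (w2 := wallis (S (S n))) in *.
  split.
  + rewrite <- e2.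
    replace (w1 ^ 2 * (INR n + 1 + 1))%R with ((INR n + 1 + 1) * (w1 * w1))%R by ring.
    apply Rmult_le_compat_l; [lra|]; apply Rmult_le_compat_l; lra.
  + replace (PI / 2 + PI / 2 * / (INR n + 1))%R with ((INR n + 1 + 1) * (w0 * w1))%R.
    2:{ rewrite <- e1; field; lra. }
    replace (w1 ^ 2 * (INR n + 1 + 1))%R with ((INR n + 1 + 1) * (w1 * w1))%R by ring.
    apply Rmult_le_compat_l; [lra|]; apply Rmult_le_compat_r; lra.
- apply is_lim_seq_const.
- replace (Finite (PI / 2)) with (Finite (PI / 2 + PI / 2 * 0)%R) by (f_equal; ring).
  apply is_lim_seq_plus'; [apply is_lim_seq_const|].
  apply is_lim_seq_mult'; [apply is_lim_seq_const | apply is_lim_recip].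
Qed.

(** * The modified gamma function *)

Definition ln_seq (m : nat) : C := RtoC (ln (INR m + 1)).

Lemma LogLike_ln_seq : LogLike 1 ln_seq.
Proof.
apply (LogLike_eventually _ (fun m => Clog (INR m + 1)) _ 0); [|apply LogLike_Clog_shift].
intros m _; unfold ln_seq; rewrite <- RtoC_plus; apply Clog_RtoC.
pose proof (pos_INR m); lra.
Qed.

Lemma Cexp_sign (u : C) (m : nat) : Cexp (RtoC (-1) ^ m * u) = Calt (Cexp u) m.
Proof.
unfold Calt; rewrite <- Nat.negb_odd.
assert (h : RtoC (-1) ^ m = if Nat.odd m then RtoC (-1) else RtoC 1).
{ induction m as [|m IH]; [reflexivity|].
  rewrite Cpow_S, IH, Nat.odd_succ, <- Nat.negb_odd; destruct (Nat.odd m); simpl; ring. }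
rewrite h; destruct (Nat.odd m); simpl.
- replace (RtoC (-1) * u) with (- u) by ring; now rewrite Cexp_opp.
- now rewrite Cmult_1_l.
Qed.

(** The product [(1 / 2) (3 / 4) ... ((2k - 1) / (2k))] satisfies the recursion of the Wallis
    integrals of even index. *)
Lemma Cexp_altsum_ln_even (k : nat) :
  Cexp (altsum ln_seq (2 * k)) = RtoC (2 / PI * wallis (2 * k)).
Proof.
pose proof PI_RGT_0.
induction k as [|k IH].
- simpl; unfold altsum; simpl; rewrite Cexp_0, wallis_0; f_equal; field; lra.
- replace (2 * S k)%nat with (S (S (2 * k))) by lia.
  change (altsum ln_seq (S (S (2 * k)))) with
    (altsum ln_seq (2 * k) + RtoC (-1) ^ (2 * k) * ln_seq (2 * k)
       + RtoC (-1) ^ S (2 * k) * ln_seq (S (2 * k))).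
  rewrite !Cexp_plus, IH, !Cexp_sign; unfold Calt.
  rewrite Nat.even_succ, <- Nat.negb_even, Nat.even_even; simpl negb; cbv iota.
  unfold ln_seq; rewrite !Cexp_RtoC.
  set (m := (2 * k)%nat); pose proof (pos_INR m).
  rewrite !exp_ln by (rewrite ?S_INR; lra).
  pose proof (wallis_rec m) as e; rewrite (S_INR (S m)) in e; rewrite S_INR in *.
  rewrite <- RtoC_inv, <- !RtoC_mult by lra.
  f_equal.
  replace (wallis (S (S m))) with ((INR m + 1) * wallis m / (INR m + 1 + 1))%R
    by (rewrite <- e; field; lra).
  field; lra.
Qed.

(** The limit exists along all indices, so it may be computed along the even ones, where
    Wallis' formula applies. *)
Lemma regularized_ln_sum : Cexp (euler_sum ln_seq) = / RtoC (sqrt (PI / 2)).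
Proof.
pose proof PI_RGT_0.
pose proof (Ccv_Cexp _ _ (regularized_log_sum_cv 1 ln_seq LogLike_ln_seq)) as h.
assert (h1 : Ccv (fun k => Cexp (regularized_log_sum ln_seq (2 * k))) (Cexp (euler_sum ln_seq))).
{ unfold Ccv in *.
  apply (is_lim_seq_subseq (fun n => Cmod (Cexp (regularized_log_sum ln_seq n) - Cexp (euler_sum ln_seq))) _
    (fun k => (2 * k)%nat)); [|exact h].
  apply eventually_subseq; intros n; lia. }
apply (Ccv_unique _ _ _ h1).
apply (Ccv_ext (fun k => RtoC (2 / PI * sqrt (wallis (2 * k) ^ 2 * (INR (2 * k) + 1)))%R)).
- intros k; unfold regularized_log_sum; rewrite Cexp_plus, Cexp_altsum_ln_even, Cexp_sign.
  unfold Calt; rewrite Nat.even_even.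
  set (m := (2 * k)%nat); pose proof (pos_INR m); pose proof (wallis_pos m).
  unfold ln_seq; rewrite <- RtoC_div, Cexp_RtoC, <- RtoC_mult by lra; f_equal.
  rewrite sqrt_mult_alt by apply pow2_ge_0.
  rewrite sqrt_pow2 by lra.
  replace (exp (ln (INR m + 1) / 2)) with (sqrt (INR m + 1)); [ring|].
  rewrite <- (exp_ln (sqrt (INR m + 1))) by (apply sqrt_lt_R0; lra); f_equal.
  rewrite <- (sqrt_sqrt (INR m + 1)) at 2 by lra.
  rewrite ln_mult by (apply sqrt_lt_R0; lra); field.
- replace (/ RtoC (sqrt (PI / 2))) with (RtoC (2 / PI * sqrt (PI / 2))).
  2:{ assert (hs : 0 < sqrt (PI / 2)) by (apply sqrt_lt_R0; lra).
      rewrite <- RtoC_inv by lra; f_equal.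
      apply Rmult_eq_reg_r with (sqrt (PI / 2)); [|lra].
      rewrite Rmult_assoc, sqrt_sqrt, Rinv_l by lra; field; lra. }
  apply Ccv_RtoC; apply is_lim_seq_mult'; [apply is_lim_seq_const|].
  apply (is_lim_seq_continuous sqrt); [apply continuity_pt_sqrt; lra|].
  apply (is_lim_seq_subseq (fun n => wallis n ^ 2 * (INR n + 1))%R _ (fun k => (2 * k)%nat));
    [|apply wallis_asymp].
  apply eventually_subseq; intros n; lia.
Qed.

Lemma Csum_S (u : nat -> C) (n : nat) : Csum u (S n) = Csum u n + u n.
Proof. reflexivity. Qed.

(** The factor of index [m] is [exp (- z / m) * (m + z) / m] to the power [(-1) ^ (m + 1)].  The sum of
    logarithms of [m + z] starts at [m = 1] here and at [m = 0] in [altsum], which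
    accounts for [Clog z] and the index [S n]. *)
Lemma tGamma_partial_product (z : C) (n : nat) :
  (forall m : nat, INR m + z <> 0) ->
  Cprod (fun k => tGamma_factor z (S k)) n =
  Cexp (- z * altsum (fun m => RtoC (recip m)) n + Clog z
        - altsum (fun m => Clog (INR m + z)) (S n) - altsum ln_seq n).
Proof.
intros hz; unfold altsum; induction n as [|n IH].
- simpl; replace (RtoC 0 + z) with z by ring.
  replace (- z * 0 + Clog z - (0 + 1 * Clog z) - 0) with (RtoC 0) by ring.
  now rewrite Cexp_0.
- set (L := fun m : nat => Clog (INR m + z)) in *.
  change (Cprod (fun k => tGamma_factor z (S k)) (S n))
    with (Cprod (fun k => tGamma_factor z (S k)) n * tGamma_factor z (S n)).
  rewrite IH.
  replace (tGamma_factor z (S n)) with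
    (Cexp (RtoC (-1) ^ n * (- z * RtoC (recip n) + (L (S n) - ln_seq n)))).
  + rewrite <- Cexp_plus; f_equal; rewrite !Csum_S, Cpow_S; unfold L; ring.
  + rewrite Cexp_sign; unfold tGamma_factor.
    replace (S n + 1)%nat with (S (S n)) by lia.
    unfold Calt; simpl Nat.even.
    pose proof (pos_INR n).
    assert (hn : RtoC (INR n) + 1 <> 0)
      by (rewrite <- RtoC_plus; intro e; apply RtoC_inj in e; lra).
    replace (Cexp (- z * RtoC (recip n) + (L (S n) - ln_seq n)))
      with (Cexp (- (z / INR (S n))) * (1 + z / INR (S n))); [reflexivity|].
    rewrite Cexp_plus, Cexp_minus; unfold L; rewrite Cexp_Clog by apply hz.
    unfold ln_seq; rewrite Cexp_RtoC, exp_ln by lra.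
    unfold recip; rewrite RtoC_inv, S_INR, RtoC_plus by lra.
    f_equal; [f_equal|]; field; exact hn.
Qed.

Lemma tGamma_regularized (z : C) :
  (forall m : nat, INR m + z <> 0) ->
  tGamma z = RtoC (sqrt (PI / 2)) / Cexp (euler_sum (fun m => Clog (INR m + z))).
Proof.
intros hz.
assert (hz0 : z <> 0) by (specialize (hz 0%nat); simpl in hz; now rewrite Cplus_0_l in hz).
set (L := fun m : nat => Clog (INR m + z)).
pose proof (regularized_log_sum_cv 1 L (LogLike_Clog_shift z)) as h1.
pose proof (regularized_log_sum_cv 1 ln_seq LogLike_ln_seq) as h2.
assert (h3 : Ccv (fun n => RtoC (-1) ^ n * (/ 2 * (L (S n) - ln_seq n))) 0).
{ apply (Ccv_of_bounded_decay _ _ 1); [intros n; rewrite Cmod_sign; lra|].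
  pose proof (bigO_recip_cv _ (Clog_shift_asymp z)) as q1; apply Ccv_incr in q1.
  pose proof (bigO_recip_cv _ (proj1 (proj2 LogLike_ln_seq))) as q2.
  pose proof (Ccv_scal _ (/ 2) _ (Ccv_plus _ _ _ _ q1 q2)) as q3.
  replace (RtoC 0) with (/ 2 * (0 + 0)) by ring.
  revert q3; apply Ccv_ext; intros n; unfold L, ln_seq; ring. }
assert (hT : Ccv (Cprod (fun k => tGamma_factor z (S k)))
  (Cexp (- z * ln 2 + Clog z - euler_sum L - euler_sum ln_seq))).
{ apply (Ccv_ext (fun n => Cexp (- z * altsum (fun m => RtoC (recip m)) n + Clog z
        - altsum L (S n) - altsum ln_seq n))).
  { intros n; symmetry; now apply tGamma_partial_product. }
  apply Ccv_Cexp.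
  apply (Ccv_ext (fun n => - z * altsum (fun m => RtoC (recip m)) n + (Clog z
     + (RtoC (-1) * regularized_log_sum L (S n) + (RtoC (-1) * regularized_log_sum ln_seq n
        + RtoC (-1) * (RtoC (-1) ^ n * (/ 2 * (L (S n) - ln_seq n)))))))).
  { intros n; unfold regularized_log_sum; simpl; field. }
  replace (- z * ln 2 + Clog z - euler_sum L - euler_sum ln_seq)
    with (- z * ln 2 + (Clog z + (RtoC (-1) * euler_sum L + (RtoC (-1) * euler_sum ln_seq
             + RtoC (-1) * 0)))) by ring.
  apply Ccv_plus; [apply Ccv_scal, altsum_recip_cv|].
  apply Ccv_plus; [apply Ccv_const|].
  apply Ccv_plus; [apply Ccv_scal; apply (proj1 (Ccv_incr _ _)), h1|].
  apply Ccv_plus; now apply Ccv_scal. }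
unfold tGamma; rewrite (Clim_seq_Ccv _ _ hT).
rewrite !Cexp_minus, Cexp_plus, Cexp_Clog, regularized_ln_sum by exact hz0.
replace (- z * ln 2) with (- (z * ln 2)) by ring; rewrite Cexp_opp.
assert (hs : RtoC (sqrt (PI / 2)) <> 0).
{ intro e; apply RtoC_inj in e; pose proof PI_RGT_0.
  assert (0 < sqrt (PI / 2)) by (apply sqrt_lt_R0; lra); lra. }
field; repeat split; auto using Cexp_neq_0.
Qed.

(** * Factorization over the roots of unity *)

(** Polynomials enter only as functions; Horner form lets their degree be lowered by
    induction. *)
Fixpoint monic (d : nat) (f : C -> C) : Prop :=
  match d with
  | O => forall X, f X = 1
  | S k => exists (c : C) (g : C -> C), monic k g /\ forall X, f X = c + X * g X
  end.

Lemma monic_add_lower (d : nat) (a : C) : forall g h,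
  monic (S d) g -> monic d h -> monic (S d) (fun X => g X + a * h X).
Proof.
induction d as [|d IH]; intros g h [c [g' [hg eg]]] hh.
- exists (c + a), g'; split; [exact hg|]; intros X; rewrite eg, hh; ring.
- destruct hh as [e [h' [hh' eh]]].
  exists (c + a * e), (fun X => g' X + a * h' X); split; [now apply IH|].
  intros X; rewrite eg, eh; ring.
Qed.

(** The inductive step uses, for [f = c + X * g],
    [f X - f a = (X - a) * g X + a * (g X - g a)]. *)
Lemma monic_divided_difference (d : nat) (a : C) : forall f,
  monic (S d) f -> exists g, monic d g /\ forall X, f X = f a + (X - a) * g X.
Proof.
induction d as [|d IH]; intros f [c [g [hg eg]]].
- exists g; split; [exact hg|]; intros X; rewrite !eg, !hg; ring.
- destruct (IH g hg) as [h [hh eh]].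
  exists (fun X => g X + a * h X); split; [now apply monic_add_lower|].
  intros X; rewrite !eg, (eh X); ring.
Qed.

Lemma monic_roots (d : nat) : forall (r : nat -> C) (f : C -> C),
  monic d f -> (forall i j, (i < j < d)%nat -> r i <> r j) ->
  (forall i, (i < d)%nat -> f (r i) = 0) ->
  forall X, f X = Cprod (fun j => X - r j) d.
Proof.
induction d as [|d IH]; intros r f hf hr h0 X; [apply hf|].
destruct (monic_divided_difference d (r d) f hf) as [g [hg eg]].
rewrite eg, h0, Cplus_0_l by lia; simpl; rewrite Cmult_comm; f_equal.
apply IH; [exact hg | intros i j hij; apply hr; lia|].
intros i hi; assert (e := eg (r i)); rewrite !h0, Cplus_0_l in e by lia.
assert (hne : r i - r d <> 0).
{ intro e0; apply (hr i d); [lia|]; replace (r i) with (r i - r d + r d) by ring.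
  rewrite e0; ring. }
replace (g (r i)) with (/ (r i - r d) * ((r i - r d) * g (r i))) by (field; exact hne).
rewrite <- e; ring.
Qed.

Lemma monic_pow_sub (n : nat) (c : C) : (0 < n)%nat -> monic n (fun X => X ^ n - c).
Proof.
assert (h : forall k, monic k (fun X => X ^ k)).
{ induction k as [|k IH]; [now intros X|].
  exists 0, (fun X => X ^ k); split; [exact IH|]; intros X; simpl; ring. }
destruct n as [|n]; [lia|]; intros _.
exists (- c), (fun X => X ^ n); split; [apply h|]; intros X; simpl; ring.
Qed.

Lemma Cexp_pow (z : C) (k : nat) : Cexp z ^ k = Cexp (INR k * z).
Proof.
induction k as [|k IH]; [simpl; rewrite Cmult_0_l; now rewrite Cexp_0|].
rewrite Cpow_S, IH, <- Cexp_plus, S_INR, RtoC_plus; f_equal; ring.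
Qed.

Lemma root_of_unity_pow (n k : nat) : (0 < n)%nat ->
  Cexp (2 * PI * Ci / INR n) ^ k = Cexp (0%R, (2 * PI * INR k / INR n)%R).
Proof.
intros hn; rewrite Cexp_pow; f_equal.
assert (h : INR n <> 0%R) by (apply not_0_INR; lia).
unfold Cdiv; rewrite <- RtoC_inv by exact h.
unfold Ci, Cmult, RtoC; simpl; f_equal; field; exact h.
Qed.

(** Both sides are monic in [X] of degree [n] with the same [n] distinct roots when [Z <> 0]. *)
Lemma prod_roots_of_unity (n : nat) (X Z : C) : (0 < n)%nat ->
  Cprod (fun j => X - Cexp (2 * PI * Ci / INR n) ^ j * Z) n = X ^ n - Z ^ n.
Proof.
intros hn; set (zeta := Cexp (2 * PI * Ci / INR n)).
assert (hN : 0 < INR n) by (apply lt_0_INR; lia).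
pose proof PI_RGT_0.
destruct (Ceq_dec Z 0) as [->|hZ].
- replace (0 ^ n) with (RtoC 0) by (destruct n; [lia|]; simpl; ring).
  replace (X ^ n - 0) with (X ^ n) by ring; clear hn hN; clearbody zeta.
  induction n as [|k IH]; [reflexivity|].
  simpl in *; rewrite IH; ring.
- symmetry; apply (monic_roots n (fun j => zeta ^ j * Z) (fun X => X ^ n - Z ^ n)).
  + now apply monic_pow_sub.
  + intros i j hij e.
    assert (e' : zeta ^ i = zeta ^ j).
    { replace (zeta ^ i) with (zeta ^ i * Z / Z) by (field; exact hZ).
      rewrite e; field; exact hZ. }
    unfold zeta in e'; rewrite !root_of_unity_pow in e' by exact hn.
    assert (hi : 0 <= INR i) by apply pos_INR.
    assert (hij' : INR i < INR j) by (apply lt_INR; lia).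
    assert (hj : INR j < INR n) by (apply lt_INR; lia).
    assert (q : forall t, (2 * PI * t / INR n = 2 * PI * (t / INR n))%R) by (intros; field; lra).
    assert (b1 : 0 <= INR i / INR n) by (apply Rdiv_le_0_compat; lra).
    assert (b2 : INR i / INR n < INR j / INR n)
      by (apply Rmult_lt_compat_r; [apply Rinv_0_lt_compat|]; lra).
    assert (b3 : INR j / INR n < 1)
      by (apply Rmult_lt_reg_r with (INR n); [lra|]; unfold Rdiv; rewrite Rmult_assoc, Rinv_l; lra).
    apply Cexp_inj_near in e'.
    * apply (f_equal Im) in e'; simpl in e'; rewrite !q in e'; nra.
    * simpl; rewrite !q; apply Rabs_def1; nra.
  + intros i hi; rewrite Cpow_mult_l, <- Cpow_mult_r, Nat.mul_comm, Cpow_mult_r.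
    unfold zeta; rewrite root_of_unity_pow by exact hn.
    replace (Cexp (0%R, (2 * PI * INR n / INR n)%R)) with (RtoC 1).
    * rewrite Cpow_1_l; ring.
    * unfold Cexp; simpl; replace (2 * PI * INR n / INR n)%R with (2 * PI)%R by (field; lra).
      rewrite exp_0, cos_2PI, sin_2PI; unfold RtoC; f_equal; ring.
Qed.

Lemma Cpow_opp_odd (y : C) (n : nat) : Nat.Odd n -> (- y) ^ n = - y ^ n.
Proof.
intros [k ->]; replace (2 * k + 1)%nat with (S (2 * k)) by lia.
rewrite !Cpow_S, !Cpow_mult_r; replace ((- y) ^ 2) with (y ^ 2) by (simpl; ring); ring.
Qed.

(** * Products over finitely many shifts *)

Lemma Cprod_ext (u v : nat -> C) (n : nat) :
  (forall j, (j < n)%nat -> u j = v j) -> Cprod u n = Cprod v n.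
Proof.
induction n as [|n IH]; intros h; [reflexivity|].
simpl; rewrite IH, h; auto.
Qed.

Lemma Cexp_Csum (u : nat -> C) (n : nat) : Cexp (Csum u n) = Cprod (fun j => Cexp (u j)) n.
Proof. induction n as [|n IH]; simpl; [apply Cexp_0|]; now rewrite Cexp_plus, IH. Qed.

Lemma LogLike_zero : LogLike 0 (fun _ => 0).
Proof.
assert (h : forall v, bigO (fun _ => 0) v) by (intros v; exists 0%R; intros m; rewrite Cmod_0; lra).
repeat split; (eapply bigO_ext; [|apply h]); intros m; unfold second_diff; rewrite ?Rmult_0_l; ring.
Qed.

Lemma LogLike_Csum (L : nat -> nat -> C) (n : nat) :
  (forall j, LogLike 1 (L j)) -> LogLike (INR n) (fun m => Csum (fun j => L j m) n).
Proof.
intros h; induction n as [|n IH]; [apply LogLike_zero|].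
rewrite S_INR; simpl; now apply LogLike_plus.
Qed.

Lemma regularized_log_sum_Csum (L : nat -> nat -> C) (n N : nat) :
  regularized_log_sum (fun m => Csum (fun j => L j m) n) N
  = Csum (fun j => regularized_log_sum (L j) N) n.
Proof.
assert (h0 : forall N, altsum (fun _ => 0) N = 0)
  by (intros k; unfold altsum; induction k as [|k IH]; simpl; [|rewrite IH]; ring).
assert (hp : forall u v N, altsum (fun m => u m + v m) N = altsum u N + altsum v N)
  by (intros u v k; unfold altsum; induction k as [|k IH]; simpl; [|rewrite IH]; ring).
unfold regularized_log_sum; induction n as [|n IH]; simpl.
- rewrite h0; field.
- rewrite <- IH, hp; field.
Qed.

Lemma Ccv_Csum (u : nat -> nat -> C) (l : nat -> C) (n : nat) :
  (forall j, (j < n)%nat -> Ccv (u j) (l j)) -> Ccv (fun N => Csum (fun j => u j N) n) (Csum l n).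
Proof.
induction n as [|n IH]; intros h; [exact (Ccv_const 0)|].
simpl; apply Ccv_plus; [apply IH; intros; apply h|apply h]; lia.
Qed.

(** Partial sums of logarithms matter only through their exponentials, so the choice of
    branches of the logarithm does not affect the products. *)
Lemma Cexp_altsum_congr (L L' : nat -> C) (n : nat) :
  (forall m, Cexp (L m) = Cexp (L' m)) -> Cexp (altsum L n) = Cexp (altsum L' n).
Proof.
intros e; unfold altsum; rewrite !Cexp_Csum; apply Cprod_ext; intros m _.
now rewrite !Cexp_sign, e.
Qed.

Lemma eventually_forall_lt (P : nat -> nat -> Prop) (n : nat) :
  (forall j, exists N, forall m, (N <= m)%nat -> P j m) ->
  exists N, forall m, (N <= m)%nat -> forall j, (j < n)%nat -> P j m.
Proof.
intros h; induction n as [|n [N IH]]; [exists 0%nat; intros; lia|].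
destruct (h n) as [N' hN']; exists (N + N')%nat; intros m hm j hj.
destruct (Nat.eq_dec j n) as [->|hne]; [apply hN'; lia | apply IH; lia].
Qed.

(** Additivity holds as soon as the arguments add up to less than [PI]. *)
Lemma Clog_Cprod (b : nat -> C) (n : nat) (t : R) :
  (forall j, (j < n)%nat -> b j <> 0 /\ Rabs (Carg (b j)) <= t) -> INR n * t < PI ->
  Clog (Cprod b n) = Csum (fun j => Clog (b j)) n.
Proof.
intros h ht.
assert (e : Cprod b n = Cexp (Csum (fun j => Clog (b j)) n)).
{ rewrite Cexp_Csum; apply Cprod_ext; intros j hj; symmetry; apply Cexp_Clog, h, hj. }
assert (hi : Rabs (Im (Csum (fun j => Clog (b j)) n)) <= INR n * t).
{ clear e ht; induction n as [|n IH].
  - simpl; rewrite Rabs_R0; lra.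
  - rewrite S_INR; change (Rabs (Im (Csum (fun j => Clog (b j)) n) + Carg (b n)) <= (INR n + 1) * t).
    eapply Rle_trans; [apply Rabs_triang|].
    assert (q1 := IH ltac:(intros; apply h; lia)); destruct (h n ltac:(lia)) as [_ q2]; lra. }
apply Cexp_inj_near.
- rewrite Cexp_Clog; [exact e|]; rewrite e; apply Cexp_neq_0.
- change (Rabs (Carg (Cprod b n) - Im (Csum (fun j => Clog (b j)) n)) < 2 * PI).
  pose proof (Carg_bounds (Cprod b n)); apply Rabs_le_between in hi; apply Rabs_def1; lra.
Qed.

Lemma Carg_shift_small (z : C) (t : R) : 0 < t -> exists N, forall m, (N <= m)%nat ->
  INR m + z <> 0 /\ Rabs (Carg (INR m + z)) <= t.
Proof.
intros ht; destruct (shift_far z) as [N hN]; destruct (exists_nat_ge (Cmod z / t + Cmod z)) as [N' hN'].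
exists (N + N')%nat; intros m hm.
destruct (hN m ltac:(lia)) as [h1 _]; specialize (hN' m ltac:(lia)).
split; [apply neq_0_of_Re_pos; lra|].
eapply Rle_trans; [apply Carg_le; lra|].
assert (er : Re (INR m + z) = (INR m + Re z)%R) by (destruct z; unfold Re, RtoC; simpl; ring).
assert (ei : Im (INR m + z) = Im z) by (destruct z; unfold Im, RtoC; simpl; ring).
pose proof (re_le_Cmod z) as q; apply Rabs_le_between in q.
rewrite ei; pose proof (im_le_Cmod z).
assert (Cmod z / t <= Re (INR m + z)) by lra.
apply Rmult_le_reg_r with (Re (INR m + z)); [lra|].
unfold Rdiv; rewrite Rmult_assoc, Rinv_l, Rmult_1_r by lra.
apply Rle_trans with (t * (Cmod z / t))%R; [|apply Rmult_le_compat_l; lra].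
replace (t * (Cmod z / t))%R with (Cmod z) by (field; lra); lra.
Qed.

(** The sequence [S] of sums of principal logarithms serves the factored reading; the principal
    logarithms [A] of the products coincide with it from some index on. *)
Lemma zeta_products_of_shifts (n : nat) (z : nat -> C)
    (a : nat -> C) (b : nat -> nat -> C) : (0 < n)%nat ->
  (forall j m, (j < n)%nat -> INR m + z j <> 0) ->
  (forall m j, b m j = INR m + z j) -> (forall m, a m = Cprod (b m) n) ->
  let V := RtoC (sqrt (PI / 2)) ^ n / Cprod (fun j => tGamma (z j)) n in
  is_zeta_prod a V /\ is_zeta_prod_factored n b V.
Proof.
intros hn hz hb ha V.
set (L := fun j m : nat => Clog (INR m + z j)).
set (S := fun m => Csum (fun j => L j m) n).
assert (hN : 0 < INR n) by (apply lt_0_INR; lia).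
assert (hL : forall j, LogLike 1 (L j)) by (intros j; apply LogLike_Clog_shift).
assert (hS : LogLike (INR n) S) by (apply LogLike_Csum, hL).
assert (eS : forall m, Cexp (S m) = Cprod (b m) n).
{ intros m; unfold S; rewrite Cexp_Csum; apply Cprod_ext; intros j hj; rewrite hb.
  apply Cexp_Clog, hz, hj. }
assert (hnz : forall m, Cprod (b m) n <> 0) by (intros m; rewrite <- eS; apply Cexp_neq_0).
assert (hV : Ccv (fun N => Cexp (regularized_log_sum S N)) V).
{ replace V with (Cexp (Csum (fun j => euler_sum (L j)) n)).
  - apply Ccv_Cexp.
    apply (Ccv_ext (fun N => Csum (fun j => regularized_log_sum (L j) N) n)).
    + intros N; symmetry; apply regularized_log_sum_Csum.
    + apply Ccv_Csum; intros j _; exact (regularized_log_sum_cv 1 _ (hL j)).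
  - rewrite Cexp_Csum.
    unfold V; rewrite (Cprod_ext (fun j => tGamma (z j))
      (fun j => RtoC (sqrt (PI / 2)) / Cexp (euler_sum (L j))))
      by (intros j hj; apply tGamma_regularized; intros m; now apply hz).
    assert (hs : RtoC (sqrt (PI / 2)) <> 0).
    { intro e; apply RtoC_inj in e; pose proof PI_RGT_0.
      assert (0 < sqrt (PI / 2)) by (apply sqrt_lt_R0; lra); lra. }
    assert (hP : forall k, Cprod (fun j => Cexp (euler_sum (L j))) k <> 0)
      by (intros k; rewrite <- Cexp_Csum; apply Cexp_neq_0).
    replace (Cprod (fun j => RtoC (sqrt (PI / 2)) / Cexp (euler_sum (L j))) n)
      with (RtoC (sqrt (PI / 2)) ^ n / Cprod (fun j => Cexp (euler_sum (L j))) n).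
    + field; auto using Cpow_nz.
    + clear - hP; induction n as [|n IH]; [simpl; field|].
      change (Cprod (fun j => RtoC (sqrt (PI / 2)) / Cexp (euler_sum (L j))) (Datatypes.S n))
        with (Cprod (fun j => RtoC (sqrt (PI / 2)) / Cexp (euler_sum (L j))) n
              * (RtoC (sqrt (PI / 2)) / Cexp (euler_sum (L n)))).
      rewrite <- IH, Cpow_S; specialize (hP n); simpl; field; auto using Cexp_neq_0. }
split.
- split; [intros m; rewrite ha; apply hnz|].
  destruct (eventually_forall_lt
    (fun j m => INR m + z j <> 0 /\ Rabs (Carg (INR m + z j)) <= 3 / INR n) n) as [N hNm].
  (* The [n] arguments then add up to at most 3, which is less than [PI]. *)
  { intros j; apply Carg_shift_small, Rdiv_lt_0_compat; lra. }
  set (A := fun m => Clog (a m)).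
  assert (eA : forall m, (N <= m)%nat -> S m = A m).
  { intros m hm; unfold A; rewrite ha, (Cprod_ext _ (fun j => INR m + z j)) by auto.
    symmetry; apply (Clog_Cprod _ _ (3 / INR n)); [now apply hNm|].
    replace (INR n * (3 / INR n))%R with 3%R by (field; lra).
    pose proof PI2_3_2; lra. }
  apply (zeta_reg_value_LogLike (INR n) A); [now apply (LogLike_eventually _ S _ N) | exact hN | |].
  + intros m s; unfold Cpower; f_equal; unfold A; ring.
  + revert hV; apply Ccv_ext_loc; exists N; intros m hm.
    unfold regularized_log_sum; rewrite !Cexp_plus, (eA m hm); f_equal.
    apply Cexp_altsum_congr; intros k; unfold A; rewrite eS, Cexp_Clog, ha; [reflexivity|].
    rewrite ha; apply hnz.
- split; [exact hnz|].
  apply (zeta_reg_value_LogLike (INR n) S); [exact hS | exact hN | | exact hV].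
  intros m s; unfold Cpower, S.
  replace (- (s * Csum (fun j => L j m) n)) with (Csum (fun j => - s * L j m) n).
  + rewrite Cexp_Csum; apply Cprod_ext; intros j _; rewrite hb; reflexivity.
  + clear; induction n as [|n IH]; simpl; [|rewrite IH]; ring.
Qed.

Theorem corollary3p24 :
  forall (n : nat) (x y : C),
    Nat.Odd n ->
    let zeta := Cexp (2 * PI * Ci / INR n) in
    (forall j k : nat, (j < n)%nat -> x + zeta ^ j * y <> - INR k) ->
    let V := RtoC (sqrt (PI / 2)) ^ n / Cprod (fun j => tGamma (x + zeta ^ j * y)) n in
    is_zeta_prod (fun m => (INR m + x) ^ n + y ^ n) V /\
    is_zeta_prod_factored n (fun m j => INR m + x + zeta ^ j * y) V.
Proof.
intros n x y hodd zeta hne V.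
assert (hn : (0 < n)%nat) by (destruct hodd; lia).
apply (zeta_products_of_shifts n (fun j => x + zeta ^ j * y)); [exact hn | | |].
- intros j m hj e; apply (hne j m hj).
  replace (x + zeta ^ j * y) with (INR m + (x + zeta ^ j * y) - INR m) by ring.
  rewrite e; ring.
- intros m j; ring.
- intros m.
  replace ((INR m + x) ^ n + y ^ n) with ((INR m + x) ^ n - (- y) ^ n)
    by (rewrite Cpow_opp_odd by exact hodd; ring).
  rewrite <- prod_roots_of_unity by exact hn.
  apply Cprod_ext; intros j _; unfold zeta; ring.
Qed.
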